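(* Let $E \subset \mathbb{R}^2$ be a rectifiable set with $\mathcal{H}^1(E)<\infty$, let $x\mapsto\theta_x$ be a tangent field of $E$, and let $\varepsilon > 0$ be arbitrary. Then for every point $q\in\mathbb{R}^2$ there exist a polygonal path $P = \bigcup_{i=1}^n L_i\subset\mathbb{R}^2$ from the origin to $q$, with each $L_i$ a line segment, and for each $i$ a direction $\theta_i\in\mathbb{P}^1$, such that $$\Big|\bigcup_{i=1}^n\ \bigcup_{p\in L_i} \big(p+\{x\in E:\ \theta_x\notin B(\theta_i,\varepsilon)\}\big)\Big|< \varepsilon .$$
   Context: $\mathcal{H}^1$ is the 1-dimensional Hausdorff measure and $|\cdot|$ is Lebesgue measure on $\mathbb{R}^2$. $\mathbb{P}^1\simeq\mathbb{R}/\pi\mathbb{Z}$ is the set of directions (unoriented) in $\mathbb{R}^2$, with its quotient (arc-length) metric; $B(\theta,\varepsilon)\subset\mathbb{P}^1$ is the open ball of radius $\varepsilon$. A set $E\subset\mathbb{R}^2$ is rectifiable if $\mathcal{H}^1$-a.e. point of $E$ can be covered by countably many $C^1$ curves. A tangent field of $E$ is a map $x\mapsto\theta_x$ from $E$ to $\mathbb{P}^1$ such that for any $C^1$ curve $\Gamma$, the tangent direction of $\Gamma$ at $x$ equals $\theta_x$ for $\mathcal{H}^1$-a.e. $x\in\Gamma\cap E$. Such a field exists and is unique up to an $\mathcal{H}^1$-null subset of $E$; the statement is for any choice of pointwise representative. A polygonal path is a concatenation of finitely many consecutive line segments. *)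

(* Defs.v *)
From HB Require Import structures.
From mathcomp Require Import all_boot all_order all_algebra.
From mathcomp Require Import all_classical all_reals all_analysis.

Set Implicit Arguments.
Unset Strict Implicit.
Unset Printing Implicit Defensive.

Import Order.TTheory GRing.Theory Num.Theory.
Import numFieldNormedType.Exports.

Local Open Scope ring_scope.
Local Open Scope classical_set_scope.

(* The norm that the library puts on R * R is the sup norm; the Euclidean
   distance is needed for Hausdorff measure. *)
Definition edist2 (R : realType) (x y : R * R) : R :=
  Num.sqrt ((x.1 - y.1) ^+ 2 + (x.2 - y.2) ^+ 2).

(* The point 0 is added so that the empty set has diameter 0, not -oo. *)
Definition ediam (R : realType) (U : set (R * R)) : \bar R :=
  ereal_sup ([set 0%E] `|` [set (edist2 x y)%:E | x in U & y in U]).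

Definition hausdorff1_delta (R : realType) (delta : R) (A : set (R * R)) :
    \bar R :=
  ereal_inf [set (\sum_(0 <= k <oo) ediam (U k))%E | U in
    [set U : (set (R * R))^nat |
      A `<=` \bigcup_k U k /\ forall k, (ediam (U k) <= delta%:E)%E]].

(* Normalized so as to give segments their length. *)
Definition hausdorff1 (R : realType) (A : set (R * R)) : \bar R :=
  ereal_sup [set hausdorff1_delta delta A | delta in [set d : R | 0 < d]].

(* The product measure is only meaningful on measurable sets, hence the passage
   to its outer extension: Lebesgue outer measure, defined on all sets. *)
Definition lebesgue2 (R : realType) (A : set (R * R)) : \bar R :=
  mu_ext (@lebesgue_measure R \x @lebesgue_measure R)%E A.

Definition eq_mod_pi (R : realType) (a b : R) : bool :=
  `[< exists k : int, a - b = k%:~R * pi >].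

Lemma eq_mod_pi_refl (R : realType) : reflexive (@eq_mod_pi R).
Proof. by move=> a; apply/asboolP; exists 0; rewrite subrr mul0r. Qed.

Lemma eq_mod_pi_sym (R : realType) : symmetric (@eq_mod_pi R).
Proof.
move=> a b; apply/asboolP/asboolP => -[k hk];
  by exists (- k); rewrite -opprB hk intrN mulNr.
Qed.

Lemma eq_mod_pi_trans (R : realType) : transitive (@eq_mod_pi R).
Proof.
move=> b a c /asboolP[k hk] /asboolP[l hl]; apply/asboolP; exists (k + l).
by rewrite intrD mulrDl -hk -hl addrA subrK.
Qed.

Canonical eq_mod_pi_equiv (R : realType) : equiv_rel R :=
  EquivRel (@eq_mod_pi R) (@eq_mod_pi_refl R) (@eq_mod_pi_sym R)
    (@eq_mod_pi_trans R).

Definition direction (R : realType) : Type :=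
  {eq_quot @eq_mod_pi_equiv R}%qT.

Definition dir_of_angle (R : realType) (a : R) : direction R :=
  (\pi_{eq_quot @eq_mod_pi_equiv R} a)%qT.

Definition dir_dist (R : realType) (u v : direction R) : R :=
  inf [set r | exists a b : R,
    [/\ dir_of_angle a = u, dir_of_angle b = v & r = `|a - b|]].

Definition dir_ball (R : realType) (u : direction R) (e : R) :
    set (direction R) :=
  [set v | dir_dist u v < e].

(* r may be negative: directions are unoriented. *)
Definition has_direction (R : realType) (w : R * R) (u : direction R) : Prop :=
  w != 0 /\ exists a r : R, dir_of_angle a = u /\ w = (r * cos a, r * sin a).

(* The C^1 curve is gamma @` `[a, b]. A C^1 map on a compact interval is the
   restriction of a C^1 map on the line, so gamma is taken to be C^1 on R; it
   is regular on [a, b], so that the curve has tangents. *)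
Definition C1_curve (R : realType) (gamma : R -> R * R) (a b : R) : Prop :=
  [/\ a < b, forall t, derivable gamma t 1, continuous gamma^`() &
      forall t, t \in `[a, b]%R -> gamma^`() t != 0].

(* A curve may pass through x several times (this happens with different
   tangents at only countably many points); u has to be tangent at each
   passage. *)
Definition tangent_direction (R : realType) (gamma : R -> R * R) (a b : R)
    (x : R * R) (u : direction R) : Prop :=
  forall t, t \in `[a, b]%R -> gamma t = x -> has_direction (gamma^`() t) u.

Definition rectifiable (R : realType) (E : set (R * R)) : Prop :=
  exists (gamma : nat -> R -> R * R) (a b : nat -> R),
    (forall k, C1_curve (gamma k) (a k) (b k)) /\
    hausdorff1 (E `\` \bigcup_k (gamma k @` `[a k, b k])) = 0%E.

(* Only the values of theta on E matter. *)
Definition tangent_field (R : realType) (E : set (R * R))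
    (theta : R * R -> direction R) : Prop :=
  forall (gamma : R -> R * R) (a b : R), C1_curve gamma a b ->
    hausdorff1 [set x | (gamma @` `[a, b] `&` E) x /\
                        ~ tangent_direction gamma a b x (theta x)] = 0%E.

Definition segment (R : realType) (x y : R * R) : set (R * R) :=
  [set (1 - t) *: x + t *: y | t in `[0, 1]].

(* The path with the n sides segment (v i) (v i.+1), i < n. *)
Definition polygonal_path (R : realType) (n : nat) (v : nat -> R * R)
    (p q : R * R) : Prop :=
  [/\ (0 < n)%N, v 0%N = p, v n = q &
      forall i, (i < n)%N -> v i != v i.+1].

(* Main.v *)
Require Import Defs.
From HB Require Import structures.
From mathcomp Require Import all_boot all_order all_algebra.
From mathcomp Require Import all_classical all_reals all_analysis.
From mathcomp Require Import ring lra zify.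

Set Implicit Arguments.
Unset Strict Implicit.
Unset Printing Implicit Defensive.

Import Order.TTheory GRing.Theory Num.Theory.
Import numFieldNormedType.Exports.

Local Open Scope ring_scope.
Local Open Scope classical_set_scope.

(** Moving a set along a segment costs little area where the set is tangent to the
    segment. So suppose, as a model, that [E] consists of pieces which are almost
    parallel to finitely many directions. Replace a segment in one of these
    directions by a very fine zigzag along two others. On each side of the zigzag two
    groups of pieces now cost little: those parallel to the side itself, and those
    parallel to the original segment, because the zigzag stays in a thin
    neighbourhood of it. Replace the sides again by much finer zigzags, and so on.
    Each generation frees one more direction on every edge, until the pieces which
    are not free on a given edge all have directions in one short arc of the
    circle of directions, and these are the ones that the statement allows to drop.

    The difficulty is that the cost is controlled only by the angle [h] between a
    piece and its direction, so the directions [k * h] must be arbitrarily dense and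
    the number of generations is of order [1 / h], while zigzags lengthen the path.
    The remedy is that the free directions always form a fan of consecutive multiples
    of [h], that an edge is in an extreme direction of its fan, and that the next
    zigzag uses the neighbours of the two extremes. The stretching factors then
    telescope ([fan_ratio]) and the total length stays bounded by a constant which
    depends only on the gap left by the last fan ([fan_lower_bound]). This induction
    is [good_fan]. As an arc of length [l] costs at most a constant times [h * l] per
    unit of length along the edges that free it ([lebesgue2_arc_tube]), the total
    cost tends to 0 with [h].

    Reduction to the model: by rectifiability, finitely many C1 curves contain all of
    [E] except a set of small measure ([rectifiable_split]), and each curve is cut
    into arcs on which the tangent varies by less than [h] ([C1_curve_arcs]). The
    exceptional set cannot be handled with neighbourhoods, as it may be dense, but
    it sweeps an area at most a constant times its measure times the length of the
    path ([lebesgue2_minksum_segment]), which is bounded independently of [h].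
    Finding finitely many curves rests on the additivity of the Hausdorff measure,
    that is on Caratheodory's criterion for closed sets ([closed_caratheodory]); the
    set [E] itself may be non-measurable.

    Distances and tubes are taken in the sup norm, which is bounded by the Euclidean
    norm; this changes only the constants. *)

(** * Planar Lebesgue outer measure *)

Definition square {R : realType} (c : R * R) (r : R) : set (R * R) :=
  [set x | `|x - c| <= r].

Lemma norm_pair_le {R : realType} (x : R * R) (r : R) :
  (`|x| <= r) = (`|x.1| <= r) && (`|x.2| <= r).
Proof. by rewrite prod_normE ge_max. Qed.

Lemma squareE {R : realType} (c : R * R) (r : R) :
  square c r = `[c.1 - r, c.1 + r]%classic `*` `[c.2 - r, c.2 + r]%classic.
Proof.
apply/seteqP; split=> x; rewrite /square /= norm_pair_le /= !in_itv /= !ler_distl.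
  by move=> /andP[].
by move=> [-> ->].
Qed.

Section Lebesgue2.
Context {R : realType}.

Lemma lebesgue2_0 : @lebesgue2 R set0 = 0%E.
Proof. by apply: mu_ext0 => // X; exact: measure_ge0. Qed.

Lemma lebesgue2_ge0 A : (0 <= @lebesgue2 R A)%E.
Proof. by apply: mu_ext_ge0 => // X; exact: measure_ge0. Qed.

Lemma le_lebesgue2 : {homo @lebesgue2 R : A B / A `<=` B >-> (A <= B)%E}.
Proof. exact: le_mu_ext. Qed.

Lemma lebesgue2_sigma_subadditive : sigma_subadditive (@lebesgue2 R).
Proof. by apply: mu_ext_sigma_subadditive => // X; exact: measure_ge0. Qed.

HB.instance Definition _ := isOuterMeasure.Build R (R * R)%type (@lebesgue2 R)
  lebesgue2_0 lebesgue2_ge0 le_lebesgue2 lebesgue2_sigma_subadditive.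

Lemma lebesgue2_square c r : 0 <= r ->
  lebesgue2 (square c r) = ((2 * r) ^+ 2)%:E :> \bar R.
Proof.
move=> r0; rewrite /lebesgue2 squareE.
have mI (a : R) : measurable (`[a - r, a + r]%classic : set (measurableTypeR R)).
  exact: measurable_itv.
have lI (a : R) : @lebesgue_measure R `[(a - r)%R, (a + r)%R]%classic = (2 * r)%:E.
  rewrite lebesgue_measure_itv /= lte_fin; case: ltP => h.
    by rewrite -EFinD; congr EFin; ring.
  by congr EFin; lra.
rewrite measurable_mu_extE; last by apply: measurableX; exact: mI.
apply: etrans; first by
  apply: (product_measure1E (@lebesgue_measure R) (@lebesgue_measure R)); exact: mI.
by rewrite expr2 EFinM; congr (_ * _)%E; exact: lI.
Qed.

End Lebesgue2.

Lemma lebesgue2_bigcup_le {R : realType} (F : nat -> set (R * R)) (n : nat)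
    (r : nat -> R) :
  (forall i, (i < n)%N -> (lebesgue2 (F i) <= (r i)%:E)%E) ->
  (lebesgue2 (\bigcup_(i in `I_n) F i) <= (\sum_(i < n) r i)%:E)%E.
Proof.
move=> h; rewrite bigcup_mkord.
apply: le_trans; first exact: (outer_measure_subadditive (@lebesgue2 R)).
by rewrite -sumEFin; apply: lee_sum => i _; exact: h.
Qed.

Lemma lebesgue2_bigcup_le_const {R : realType} (F : nat -> set (R * R)) (n : nat)
    (r : R) :
  (forall i, (i < n)%N -> (lebesgue2 (F i) <= r%:E)%E) ->
  (lebesgue2 (\bigcup_(i in `I_n) F i) <= (n%:R * r)%:E)%E.
Proof.
move=> /lebesgue2_bigcup_le /le_trans; apply.
by rewrite sumr_const card_ord mulr_natl.
Qed.

(** * One-dimensional Hausdorff measure is additive on closed sets *)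

Section Hausdorff.
Context {R : realType}.
Implicit Types (U A B C : set (R * R)) (d : R).
Local Open Scope ereal_scope.

Lemma ediam_ge0 U : 0 <= ediam U.
Proof. by apply: ereal_sup_ubound; left. Qed.

Lemma ediam0 : ediam (@set0 (R * R)) = 0.
Proof.
apply/eqP; rewrite eq_le ediam_ge0 andbT; apply: ge_ereal_sup => x [->//|].
by move=> [a []].
Qed.

Lemma le_ediam U V : U `<=` V -> ediam U <= ediam V.
Proof.
move=> UV; apply: ge_ereal_sup => x [->|[a Ua [b Ub <-]]]; apply: ereal_sup_ubound.
  by left.
by right; exists a; [exact: UV|exists b => //; exact: UV].
Qed.

Lemma edist2_ge_norm (x y : R * R) : (`|x - y| <= edist2 x y)%R.
Proof.
rewrite norm_pair_le /edist2 /=; apply/andP; split; rewrite -sqrtr_sqr ler_wsqrtr //.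
  by rewrite lerDl sqr_ge0.
by rewrite lerDr sqr_ge0.
Qed.

Lemma norm_le_ediam U (x y : R * R) : U x -> U y -> `|x - y|%:E <= ediam U.
Proof.
move=> Ux Uy; apply: (@le_trans _ _ (edist2 x y)%:E).
  by rewrite lee_fin edist2_ge_norm.
by apply: ereal_sup_ubound; right; exists x => //; exists y.
Qed.

(** Assigning infinite weight to the sets of diameter larger than [d] turns the
    premeasure [hausdorff1_delta d] into an infimum over all countable covers, so
    that the general theory of outer measures generated by a set function
    applies to it. *)
Definition gauge d U := if ediam U <= d%:E then ediam U else +oo.

Lemma gauge_ge0 d U : 0 <= gauge d U.
Proof. by rewrite /gauge; case: ifP => // _; exact: ediam_ge0. Qed.

Lemma gauge0 d : (0 <= d)%R -> gauge d set0 = 0.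
Proof. by move=> d0; rewrite /gauge ediam0 lee_fin d0. Qed.

(** All sets are allowed as members of a cover: the plane is given the
    sigma-algebra of all its subsets. *)
Definition discrete : Type := g_sigma_algebraType [set: set (R * R)].
HB.instance Definition _ := Measurable.on discrete.

Lemma hausdorff1_deltaE d A : (0 <= d)%R ->
  hausdorff1_delta d A = mu_ext (gauge d : set discrete -> \bar R) A.
Proof.
move=> d0; apply/eqP; rewrite eq_le; apply/andP; split.
  apply: le_ereal_inf_tmp => _ [U [mU AU] <-].
  have [h|] := pselect (forall k, ediam (U k) <= d%:E).
    apply: ereal_inf_lbound; exists U => //.
    by apply: eq_eseriesr => k _; rewrite /gauge h.
  move=> /existsNP[k hk]; rewrite (eseries_pinfty (k := k)) ?leey //.
    by move=> n _; rewrite gt_eqF // (lt_le_trans _ (gauge_ge0 _ _)).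
  by rewrite /gauge; case: ifP.
apply: le_ereal_inf_tmp => _ [U [AU hU] <-].
apply: ereal_inf_lbound; exists U.
  by split=> // k; exact: sub_sigma_algebra.
by apply: eq_eseriesr => k _; rewrite /gauge hU.
Qed.

Lemma hausdorff1_delta_ge0 d A : 0 <= hausdorff1_delta d A.
Proof.
apply: le_ereal_inf_tmp => _ [U [AU hU] <-].
by apply: nneseries_ge0 => k _ _; exact: ediam_ge0.
Qed.

Lemma hausdorff1_delta_le d A : (0 < d)%R -> hausdorff1_delta d A <= hausdorff1 A.
Proof. by move=> d0; apply: ereal_sup_ubound; exists d. Qed.

Lemma le_hausdorff1_delta d e A : (d <= e)%R ->
  hausdorff1_delta e A <= hausdorff1_delta d A.
Proof.
move=> de; apply: le_ereal_inf_tmp => _ [U [AU hU] <-].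
apply: ereal_inf_lbound; exists U => //; split=> // k.
by rewrite (le_trans (hU k)) // lee_fin.
Qed.

Lemma hausdorff1_0 : @hausdorff1 R set0 = 0.
Proof.
apply/eqP; rewrite eq_le; apply/andP; split.
  apply: ge_ereal_sup => _ [d /= d0 <-].
  rewrite hausdorff1_deltaE; last exact/ltW.
  rewrite mu_ext0 //; [apply: gauge0; exact/ltW|exact: gauge_ge0].
by apply: le_trans (hausdorff1_delta_le _ ltr01); exact: hausdorff1_delta_ge0.
Qed.

Lemma hausdorff1_ge0 A : 0 <= hausdorff1 A.
Proof.
by apply: le_trans (hausdorff1_delta_le _ ltr01); exact: hausdorff1_delta_ge0.
Qed.

Lemma le_hausdorff1 : {homo @hausdorff1 R : A B / A `<=` B >-> A <= B}.
Proof.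
move=> A B AB; apply: ge_ereal_sup => _ [d /= d0 <-].
apply: le_trans (hausdorff1_delta_le _ d0).
by rewrite !hausdorff1_deltaE; [exact: le_mu_ext|exact/ltW|exact/ltW].
Qed.

Lemma hausdorff1_sigma_subadditive : sigma_subadditive (@hausdorff1 R).
Proof.
move=> F; apply: ge_ereal_sup => _ [d /= d0 <-].
rewrite hausdorff1_deltaE; last exact/ltW.
apply: le_trans.
  by apply: (@mu_ext_sigma_subadditive _ discrete R (gauge d)); exact: gauge_ge0.
apply: lee_nneseries => [k _ _|k _]; first by apply: mu_ext_ge0; exact: gauge_ge0.
by rewrite -hausdorff1_deltaE; [exact: hausdorff1_delta_le|exact/ltW].
Qed.

HB.instance Definition _ := isOuterMeasure.Build R (R * R)%type (@hausdorff1 R)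
  hausdorff1_0 hausdorff1_ge0 le_hausdorff1 hausdorff1_sigma_subadditive.

Lemma hausdorff1U A B : hausdorff1 (A `|` B) <= hausdorff1 A + hausdorff1 B.
Proof. exact: (outer_measureU2 (@hausdorff1 R)). Qed.

(** A set of diameter less than [r] meets at most one of two sets at distance at
    least [r]; a fine cover of the union thus splits into covers of each. *)
Lemma hausdorff1_delta_separated (r d : R) A B : (d < r)%R ->
  (forall a b, A a -> B b -> r <= `|a - b|)%R ->
  hausdorff1_delta d A + hausdorff1_delta d B <= hausdorff1_delta d (A `|` B).
Proof.
move=> dr AB; apply: le_ereal_inf_tmp => _ [U [ABU hU] <-].
have le_sum : \sum_(0 <= k <oo) (ediam (U k `&` A) + ediam (U k `&` B)) <=
    \sum_(0 <= k <oo) ediam (U k).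
  apply: lee_nneseries => [k _ _|k _]; first by apply: adde_ge0; exact: ediam_ge0.
  have [[a [Ua Aa]]|/forallNP nA] := pselect (exists a, (U k `&` A) a).
    rewrite (_ : U k `&` B = set0).
      by rewrite ediam0 adde0 le_ediam.
    apply/seteqP; split=> // b [Ub Bb] /=.
    have := le_trans (norm_le_ediam Ua Ub) (hU k).
    by rewrite lee_fin leNgt (lt_le_trans dr) // AB.
  rewrite (_ : U k `&` A = set0); last by apply/seteqP; split=> // a /nA.
  by rewrite ediam0 add0e le_ediam.
apply: le_trans le_sum; rewrite nneseriesD; do ?by move=> *; exact: ediam_ge0.
apply: leeD; apply: ereal_inf_lbound.
  exists (fun k => U k `&` A) => //; split.
    move=> x Ax; have [k _ Uk] := ABU x (or_introl Ax); by exists k.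
  by move=> k; apply: le_trans (hU k); apply: le_ediam.
exists (fun k => U k `&` B) => //; split.
  move=> x Ax; have [k _ Uk] := ABU x (or_intror Ax); by exists k.
by move=> k; apply: le_trans (hU k); apply: le_ediam.
Qed.

Lemma hausdorff1_separated (r : R) A B : (0 < r)%R ->
  (forall a b, A a -> B b -> r <= `|a - b|)%R ->
  hausdorff1 A + hausdorff1 B <= hausdorff1 (A `|` B).
Proof.
move=> r0 AB; set M := hausdorff1 (A `|` B).
have [->|/eqP Mfin] := eqVneq M +oo; first exact: leey.
have fin C : C `<=` A `|` B -> hausdorff1 C \is a fin_num.
  move=> CAB; rewrite ge0_fin_numE ?hausdorff1_ge0 //.
  by apply: le_lt_trans (le_hausdorff1 CAB) _; rewrite ltey; apply/eqP.
have fB : hausdorff1 B \is a fin_num by apply: fin; exact: subsetUr.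
(* The two suprema are taken over independent scales: compare both with a
   common finer one. *)
have key d e : (0 < d)%R -> (0 < e)%R ->
    hausdorff1_delta d A + hausdorff1_delta e B <= M.
  move=> d0 e0; pose f := (Num.min (Num.min d e) (r / 2))%R.
  have f0 : (0 < f)%R by rewrite !lt_min d0 e0 divr_gt0.
  have fr : (f < r)%R by rewrite gt_min; apply/orP; right; lra.
  apply: le_trans (hausdorff1_delta_le _ f0).
  apply: le_trans (hausdorff1_delta_separated fr AB).
  by apply: leeD; apply: le_hausdorff1_delta; rewrite !ge_min lexx ?orbT.
rewrite -leeBrDr //; apply: ge_ereal_sup => _ [d /= d0 <-].
have fA : hausdorff1_delta d A \is a fin_num.
  rewrite ge0_fin_numE ?hausdorff1_delta_ge0 //.
  apply: le_lt_trans (hausdorff1_delta_le _ d0) _.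
  by rewrite -ge0_fin_numE ?hausdorff1_ge0 //; apply: fin; exact: subsetUl.
rewrite leeBrDr // addeC -leeBrDr //; apply: ge_ereal_sup => _ [e /= e0 <-].
by rewrite leeBrDr // addeC; exact: key.
Qed.

End Hausdorff.

Lemma nneseries_tail_small {R : realType} (f : nat -> \bar R) (e : R) :
  (forall k, 0 <= f k)%E -> (\sum_(0 <= k <oo) f k < +oo)%E -> 0 < e ->
  exists n : nat, (\sum_(n <= k <oo) f k < e%:E)%E.
Proof.
move=> f0 fy e0.
have /fine_cvgP[[N _ hN] /cvgrPdist_lt /(_ e e0) [M _ hM]] :
  (\sum_(n <= k <oo) f k)%E @[n --> \oo] --> 0%:E.
  by apply: nneseries_tail_cvg => // k _.
exists (maxn N M); have := hM (maxn N M) (leq_maxr _ _).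
rewrite /= sub0r normrN => h.
rewrite -(fineK (hN (maxn N M) (leq_maxl _ _))) lte_fin.
by apply: le_lt_trans h; exact: ler_norm.
Qed.

(** Caratheodory's criterion for a closed set [C]: the part of [X] outside [C] is
    exhausted by the sets [away n] at distance at least [1 / n] from [C], which are
    separated from [C]; the defect is controlled by the shells between
    consecutive ones. *)
Section ClosedCaratheodory.
Context {R : realType}.
Variables (C X : set (R * R)).
Hypotheses (clC : closed C) (finX : (hausdorff1 X < +oo)%E).

(** Writing the bound on the distance [d] as [1 <= n * d] rather than [1 / n <= d]
    makes [away 0] empty as soon as [C] has a point. *)
Definition away (n : nat) : set (R * R) :=
  [set x | X x /\ forall y, C y -> 1 <= n%:R * `|x - y|].
Definition shell (n : nat) := away n.+1 `\` away n.

Lemma le_away m n : (m <= n)%N -> away m `<=` away n.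
Proof.
move=> mn x [Xx h]; split=> // y /h /le_trans; apply.
by rewrite ler_wpM2r // ler_nat.
Qed.

(** Shells whose indices have the same parity are separated from each other, so
    their measures add up to at most that of [X]. *)
Lemma sum_shell_le (e n : nat) :
  (\sum_(0 <= i < n) hausdorff1 (shell (i.*2 + e)) <=
   hausdorff1 (away (n.*2 + e).-1))%E.
Proof.
elim: n => [|n ih]; first by rewrite big_geq // hausdorff1_ge0.
rewrite big_nat_recr //=; set m := (n.*2 + e)%N.
apply: le_trans (_ : hausdorff1 (away m.-1) + hausdorff1 (shell m) <= _)%E.
  exact: leeD.
pose r : R := if (1 < m)%N then (m.-1)%:R^-1 - m%:R^-1 else 1.
have r0 : 0 < r.
  rewrite /r; case: ifP => // m1; rewrite subr_gt0 ltf_pV2 ?posrE ?ltr0n ?ltr_nat; lia.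
apply: le_trans (hausdorff1_separated r0 _) (le_hausdorff1 _).
- move=> a b [Xa ha] [[Xb hb] nb].
  have /existsNP[y /not_implyP[Cy /negP]] : ~ forall y, C y -> 1 <= m%:R * `|b - y|.
    by move=> h; apply: nb.
  rewrite -ltNge => by1; have ay := ha y Cy.
  have m1 : (1 < m)%N.
    rewrite ltnNge; apply/negP => m1; move: ay.
    by rewrite (_ : m.-1 = 0%N) ?mul0r ?ler10 //; lia.
  rewrite /r m1; have tri : `|a - y| <= `|a - b| + `|b - y| by exact: ler_distD.
  have h1 : (m.-1)%:R^-1 <= `|a - y|.
    by rewrite -ler_pdivrMl ?mulr1 // in ay; rewrite ltr0n; lia.
  have h2 : `|b - y| < m%:R^-1.
    by rewrite -ltr_pdivlMl ?mulr1 // in by1; rewrite ltr0n; lia.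
  by move: (`|a - y|) (`|a - b|) (`|b - y|) tri h1 h2 => *; lra.
- by move=> x [|[+ _]]; apply: le_away; rewrite /m; lia.
Qed.

Lemma shell_summable : (\sum_(0 <= i <oo) hausdorff1 (shell i) < +oo)%E.
Proof.
apply: (@le_lt_trans _ _ (hausdorff1 X + hausdorff1 X)%E); last first.
  by rewrite lte_add_pinfty.
apply: lime_le; first by apply: is_cvg_nneseries => n _ _; exact: hausdorff1_ge0.
apply: nearW => n.
apply: (@le_trans _ _ (\sum_(0 <= i < n.*2) hausdorff1 (shell i))%E).
  apply: lee_sum_nneg_natr => //; first by move=> *; exact: hausdorff1_ge0.
  by rewrite -addnn leq_addr.
have -> : (\sum_(0 <= i < n.*2) hausdorff1 (shell i) =
    \sum_(0 <= i < n) hausdorff1 (shell (i.*2 + 0)) +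
    \sum_(0 <= i < n) hausdorff1 (shell (i.*2 + 1)))%E.
  elim: n => [|n ih]; first by rewrite !big_geq // adde0.
  rewrite doubleS !big_nat_recr //= ih addn0 addn1.
  by rewrite addeACA addeA.
by apply: leeD; (apply: le_trans (sum_shell_le _ _) _; apply: le_hausdorff1 => x []).
Qed.

Lemma setD_closed_cover n :
  X `&` ~` C `<=` away n `|` \bigcup_(i in ~` `I_n) shell i.
Proof.
move=> x [Xx nCx].
have [N hN] : exists N, away N x.
  have : nbhs x (~` C) by apply: open_nbhs_nbhs; split => //; exact: closed_openC.
  move=> /nbhs_ballP[e /= e0 he]; exists (Num.truncn e^-1).+1; split=> // y Cy.
  have exy : e <= `|x - y|.
    by rewrite leNgt; apply/negP => h; apply: (he y) => //; rewrite -ball_normE.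
  rewrite -ler_pdivrMr; last by apply: lt_le_trans exy.
  rewrite mul1r; apply: (@le_trans _ _ e^-1).
    by rewrite lef_pV2 // posrE //; apply: lt_le_trans exy.
  by apply: ltW; exact: truncnS_gt.
have [An|nAn] := pselect (away n x); first by left.
right; elim: N hN => [|N ih] hN.
  by exfalso; apply: nAn; apply: le_away hN.
have [AN|nAN] := pselect (away N x); first exact: ih.
exists N => //=; apply/negP; rewrite -leqNgt leqNgt; apply/negP => Nn.
by apply: nAn; apply: le_away hN.
Qed.

Lemma closed_split_hausdorff1 :
  (hausdorff1 (X `&` C) + hausdorff1 (X `&` ~` C) <= hausdorff1 X)%E.
Proof.
apply/lee_addgt0Pr => e e0.
have [n hn] := nneseries_tail_small (fun k => hausdorff1_ge0 (shell k)) shell_summable e0.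
have h1 : (hausdorff1 (X `&` ~` C) <= hausdorff1 (away n) + e%:E)%E.
  apply: le_trans (le_hausdorff1 (setD_closed_cover n)) _.
  apply: le_trans (hausdorff1U _ _) _.
  rewrite leeD2l //; apply: ltW; apply: le_lt_trans hn.
  exact: (outer_measure_sigma_subadditive_tail (@hausdorff1 R)).
apply: le_trans (leeD2l _ h1) _; rewrite addeA leeD2r //.
have n0 : 0 < n.+1%:R^-1 :> R by rewrite invr_gt0 ltr0n.
apply: le_trans (hausdorff1_separated n0 _) (le_hausdorff1 _).
  move=> a b [Xa Ca] [Xb hb]; have := hb a Ca => h.
  rewrite distrC -[_^-1]mulr1 ler_pdivrMl ?ltr0n //; apply: le_trans h _.
  by rewrite ler_wpM2r // ler_nat.
by move=> x [[]//|[]].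
Qed.

End ClosedCaratheodory.

Lemma closed_caratheodory {R : realType} (C : set (R * R)) :
  closed C -> (@hausdorff1 R).-caratheodory C.
Proof.
move=> clC; apply: le_caratheodory_measurable => X.
suff h : (hausdorff1 (X `&` C) + hausdorff1 (X `&` ~` C) <= hausdorff1 X)%E by exact: h.
have [->|/eqP Xfin] := eqVneq (hausdorff1 X) +oo%E; first exact: leey.
by apply: closed_split_hausdorff1 => //; rewrite ltey; apply/eqP.
Qed.

(** Since the [G k] are measurable, the outer measure of [E] splits along the
    differences of their partial unions; the tail of the resulting convergent
    series is small. Finiteness of the measure of [E] is essential here. *)
Lemma hausdorff1_finite_exhaustion {R : realType} (E : set (R * R))
    (G : nat -> set (R * R)) (tau : R) :
  (forall k, closed (G k)) -> (hausdorff1 E < +oo)%E ->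
  hausdorff1 (E `\` \bigcup_k G k) = 0%E -> 0 < tau ->
  exists K : nat, (hausdorff1 (E `\` \bigcup_(k in `I_K) G k) < tau%:E)%E.
Proof.
move=> clG finE E0 tau0; pose A := seqDU G.
have caraA k : (@hausdorff1 R).-caratheodory (A k).
  apply: caratheodory_measurable_setD; first exact: closed_caratheodory.
  by apply: caratheodory_measurable_bigsetU => i; exact: closed_caratheodory.
have := caratheodory_lime_le caraA (@trivIset_seqDU _ G) E.
move=> /(fun h => le_lt_trans h finE) sumE.
have sumA : (\sum_(0 <= k <oo) hausdorff1 (E `&` A k) < +oo)%E.
  by apply: le_lt_trans sumE; rewrite leeDl // hausdorff1_ge0.
have [K hK] := nneseries_tail_small (fun k => hausdorff1_ge0 (E `&` A k)) sumA tau0.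
exists K; apply: le_lt_trans hK.
apply: (@le_trans _ _ (hausdorff1 ((E `\` \bigcup_k G k) `|`
   \bigcup_(k in ~` `I_K) (E `&` A k)))).
  apply: le_hausdorff1 => x [Ex nx].
  have [Gx|nGx] := pselect ((\bigcup_k G k) x); last by left.
  have [k _ Ak] : (\bigcup_k A k) x by rewrite /A -seqDU_bigcup_eq.
right.
  exists k => //= kK; apply: nx; exists k => //; exact: (subset_seqDU (i := k)) Ak.
apply: le_trans (hausdorff1U _ _) _.
rewrite E0 add0e; exact: (outer_measure_sigma_subadditive_tail (@hausdorff1 R)).
Qed.

(** * Area swept by a small set along a segment *)

Definition minksum {R : realType} (Z X : set (R * R)) : set (R * R) :=
  \bigcup_(z in Z) [set z + x | x in X].

Lemma sub_minksum {R : realType} (Z Z' Y Y' : set (R * R)) :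
  Z `<=` Z' -> Y `<=` Y' -> minksum Z Y `<=` minksum Z' Y'.
Proof.
move=> ZZ YY _ [z Zz [y Yy <-]]; exists z; [exact: ZZ|exists y => //; exact: YY].
Qed.

Lemma minksum_bigcup {R : realType} (Z : set (R * R)) (U : nat -> set (R * R)) :
  minksum Z (\bigcup_k U k) `<=` \bigcup_k minksum Z (U k).
Proof.
by move=> _ [z Zz [x [k _ Ukx] <-]]; exists k => //; exists z => //; exists x.
Qed.

Lemma lebesgue2_squares_le {R : realType} (X : set (R * R)) (n : nat)
    (c : nat -> R * R) (r : R) : 0 <= r ->
  X `<=` \bigcup_(i in `I_n) square (c i) r ->
  (lebesgue2 X <= (n%:R * (2 * r) ^+ 2)%:E)%E.
Proof.
move=> r0 Xc; apply: le_trans (le_lebesgue2 Xc) _.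
by apply: lebesgue2_bigcup_le_const => i _; rewrite lebesgue2_square.
Qed.

(** Squares of side comparable to [d], centred at points of the translated segment
    at distance about [d] from each other, cover everything. *)
Lemma lebesgue2_minksum_segment_diam {R : realType} (U : set (R * R)) (p q : R * R) (d : R) :
  0 < d -> d <= 2 * `|q - p| -> (forall x y, U x -> U y -> `|x - y| <= d) ->
  (lebesgue2 (minksum (segment p q) U) <= (80 * `|q - p| * d)%:E)%E.
Proof.
move=> d0 dL hU; set L := `|q - p| in dL *.
have L0 : 0 < L by lra.
have [[x0 Ux0]|/forallNP U0] := pselect (exists x0, U x0); last first.
  rewrite (_ : minksum (segment p q) U = set0); last first.
    by apply/seteqP; split=> // y [z _ [x /U0]].
  by rewrite outer_measure0 lee_fin !mulr_ge0 // ltW.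
have /andP[n1 n2] := truncn_itv (ltW (divr_gt0 L0 d0)).
set n := Num.truncn _ in n1 n2.
have Ld : L < n.+1%:R * d by rewrite -ltr_pdivrMr.
have nd : n%:R * d <= L by rewrite -ler_pdivlMr.
have n0 : 0 < n.+1%:R :> R by rewrite ltr0n.
pose c i : R * R := (1 - i%:R / n.+1%:R) *: p + (i%:R / n.+1%:R) *: q + x0.
apply: (@le_trans _ _ (n.+2%:R * (2 * (d + d)) ^+ 2)%:E).
  apply: (lebesgue2_squares_le (c := c)); first by lra.
  move=> _ [_ [t /= + <-] [x Ux <-]]; rewrite in_itv /= => /andP[t0 t1].
  have /andP[i1 i2] := truncn_itv (mulr_ge0 t0 (ltW n0)).
  set i := Num.truncn _ in i1 i2.
  exists i => /=.
    by rewrite -(ltr_nat R); apply: le_lt_trans i1 _;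
      rewrite (@le_lt_trans _ _ n.+1%:R) ?ltr_nat // ler_piMl // ltW.
  rewrite /square /=.
  have -> : (1 - t) *: p + t *: q + x - c i =
      (t - i%:R / n.+1%:R) *: (q - p) + (x - x0).
    by rewrite /c; apply/eqP; rewrite xpair_eqE /=; apply/andP; split; apply/eqP;
      rewrite /GRing.scale /=; ring.
  apply: le_trans (ler_normD _ _) _; apply: lerD; last exact: hU.
  rewrite normrZ -/L ger0_norm; last by rewrite subr_ge0 ler_pdivrMr.
  apply: (@le_trans _ _ (n.+1%:R^-1 * L)).
    rewrite ler_wpM2r ?(ltW L0) // ltW // ltrBlDr -[X in X + _]mul1r -mulrDl.
    by rewrite ltr_pdivlMr // nat1r.
  by rewrite ler_pdivrMl // ltW.
rewrite lee_fin -[n.+2]addn2 natrD.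
have -> : (n%:R + 2) * (2 * (d + d)) ^+ 2 = 16 * d * (n%:R * d + 2 * d) by ring.
have -> : 80 * L * d = 16 * d * (5 * L) by ring.
by rewrite ler_wpM2l //; lra.
Qed.

(** Valid for arbitrary sets, however irregular: cover [F] by sets of diameter at
    most the length of the segment, and add up the areas. *)
Lemma lebesgue2_minksum_segment {R : realType} (F : set (R * R)) (p q : R * R) (tau : R) :
  p != q -> (hausdorff1 F < tau%:E)%E ->
  (lebesgue2 (minksum (segment p q) F) <= (160 * tau * `|q - p|)%:E)%E.
Proof.
move=> pq Ftau; set L := `|q - p|.
have L0 : 0 < L by rewrite normr_gt0 subr_eq0 eq_sym.
have tau0 : 0 < tau by rewrite -lte_fin; apply: le_lt_trans Ftau; exact: hausdorff1_ge0.
have : (hausdorff1_delta L F < tau%:E)%E.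
  by apply: le_lt_trans Ftau; exact: hausdorff1_delta_le.
move=> /ereal_inf_lt[_ [U [FU hU] <-] sumU].
pose e := Num.min tau L.
have e0 : 0 < e by rewrite lt_min tau0.
have fU k : ediam (U k) \is a fin_num.
  by rewrite ge0_fin_numE ?ediam_ge0 //; apply: le_lt_trans (hU k) _; rewrite ltry.
(* A set of diameter 0 still needs squares of positive side, hence the extra
   summable terms; they are at most L because the covering lemma needs
   d k <= 2 L. *)
pose d k := fine (ediam (U k)) + e / (2 ^ k.+1)%:R.
have p2 k : (1 <= (2 ^ k.+1)%:R :> R) by rewrite ler1n expn_gt0.
have ek k : 0 < e / (2 ^ k.+1)%:R by rewrite divr_gt0 // (lt_le_trans _ (p2 k)).
have dU0 k : 0 <= fine (ediam (U k)) by rewrite fine_ge0 ?ediam_ge0.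
have dUL k : fine (ediam (U k)) <= L by rewrite -lee_fin fineK.
have ekL k : e / (2 ^ k.+1)%:R <= L.
  rewrite ler_pdivrMr ?(lt_le_trans _ (p2 k)) //.
  apply: (@le_trans _ _ L); first by rewrite ge_min lexx orbT.
  by rewrite ler_peMr // ltW.
have swU k : (lebesgue2 (minksum (segment p q) (U k)) <= (80 * L)%:E * (d k)%:E)%E.
  rewrite -EFinM; apply: lebesgue2_minksum_segment_diam.
  - by rewrite /d ltr_wpDl.
  - by rewrite /d -/L; have := dUL k; have := ekL k; lra.
  - move=> x y Ux Uy; rewrite /d; apply: (@le_trans _ _ (fine (ediam (U k)))).
      by rewrite -lee_fin fineK //; exact: norm_le_ediam.
    by rewrite lerDl ltW.
apply: le_trans (le_lebesgue2 (subset_trans (sub_minksum (@subset_refl _ _) FU)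
  (@minksum_bigcup _ _ _))) _.
apply: le_trans; first exact: (lebesgue2_sigma_subadditive).
apply: le_trans.
  by apply: lee_nneseries => [k _ _|k _]; [exact: lebesgue2_ge0|exact: swU].
have d0 k : (0 <= (d k)%:E)%E by rewrite lee_fin /d addr_ge0 // ltW.
have L80 : 0 <= 80 * L by rewrite mulr_ge0 // ltW.
rewrite nneseriesZl //.
have -> : (160 * tau * L)%:E = ((80 * L)%:E * (tau + tau)%:E)%E.
  by rewrite -EFinM; congr EFin; ring.
apply: lee_wpmul2l; first by rewrite lee_fin.
rewrite (eq_eseriesr (g := fun k => ediam (U k) + (e / (2 ^ k.+1)%:R)%:E)%E); last first.
  by move=> k _; rewrite /d EFinD fineK.
apply: le_trans; first by apply: epsilon_trick; [move=> k; exact: ediam_ge0|exact: ltW].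
by rewrite EFinD; apply: leeD; [exact: ltW|rewrite lee_fin ge_min lexx].
Qed.

(** * Vectors of the plane, and the mean value inequality *)

Definition uvec {R : realType} (b : R) : R * R := (cos b, sin b).
Definition nvec {R : realType} (b : R) : R * R := (- sin b, cos b).
Definition dot {R : realType} (x y : R * R) : R := x.1 * y.1 + x.2 * y.2.

Section Calculus.
Context {R : realType}.
Implicit Types (x y w : R * R) (b : R).

Lemma norm_uvec_le b : `|uvec b| <= 1.
Proof. by rewrite norm_pair_le /= cos_max sin_max. Qed.

Lemma norm_nvec_le b : `|nvec b| <= 1.
Proof. by rewrite norm_pair_le /= normrN cos_max sin_max. Qed.

Lemma dotDr w x y : dot w (x + y) = dot w x + dot w y.
Proof. by rewrite /dot /=; ring. Qed.

Lemma dotBr w x y : dot w (x - y) = dot w x - dot w y.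
Proof. by rewrite /dot /=; ring. Qed.

Lemma dotZr w (r : R) x : dot w (r *: x) = r * dot w x.
Proof. by rewrite /dot /= /GRing.scale /=; ring. Qed.

Lemma dot_uvec b : dot (uvec b) (uvec b) = 1.
Proof. by rewrite /dot /= -!expr2 cos2Dsin2. Qed.

Lemma norm_dot_le w x : `|w| <= 1 -> `|dot w x| <= 2 * `|x|.
Proof.
rewrite norm_pair_le => /andP[w1 w2].
have : `|x| <= `|x| by []; rewrite {1}norm_pair_le => /andP[x1 x2].
rewrite /dot (le_trans (ler_normD _ _)) // !normrM mulrDl mul1r.
by apply: lerD; rewrite -[leRHS]mul1r; apply: ler_pM.
Qed.

Lemma uvec_decomp b x : x = dot (uvec b) x *: uvec b + dot (nvec b) x *: nvec b.
Proof.
have e := cos2Dsin2 b.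
apply/eqP; rewrite [x]surjective_pairing xpair_eqE /dot /=; apply/andP.
rewrite /GRing.scale /=; split; apply/eqP.
  by rewrite -{1}[x.1]mulr1 -e; ring.
by rewrite -{1}[x.2]mulr1 -e; ring.
Qed.

Lemma dot_nvec_uvec a b : dot (nvec b) (uvec a) = sin (a - b).
Proof. by rewrite /dot /= sinB; ring. Qed.

Lemma is_derive_dot (gamma : R -> R * R) w (t : R) : derivable gamma t 1 ->
  is_derive t 1 (fun s => dot w (gamma s)) (dot w (gamma^`() t)).
Proof.
move=> dg.
have cdot (z : R * R) : {for z, continuous (dot w)}.
  by apply: cvgD; apply: cvgMr; [exact: cvg_fst|exact: cvg_snd].
have : (fun h => dot w (h^-1 *: ((gamma \o shift t) (h *: 1) - gamma t))) @ 0^'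
    --> dot w (gamma^`() t).
  rewrite derive1E; apply: cvg_comp; last exact: cdot.
  exact: dg.
rewrite (_ : (fun h => _) = fun h => h^-1 *:
    (((fun s => dot w (gamma s)) \o shift t) (h *: 1) - dot w (gamma t))); last first.
  apply/funext => h; rewrite /= -dotBr /dot /=.
  by rewrite /GRing.scale /=; ring.
move=> h; apply: DeriveDef; first by apply/cvg_ex; exists (dot w (gamma^`() t)).
exact/cvg_lim.
Qed.

Lemma ler_MVT (f df : R -> R) (a b M : R) :
  (forall t : R, is_derive t (1 : R) f (df t)) ->
  (forall t, t \in `[a, b]%R -> `|df t| <= M) ->
  forall s t, s \in `[a, b]%R -> t \in `[a, b]%R -> `|f s - f t| <= M * `|s - t|.
Proof.
move=> fd dfM s t; wlog st : s t / s <= t.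
  move=> H sab tab; have [st|/ltW ts] := leP s t; first exact: H.
  by rewrite distrC [`|s - t|]distrC; exact: H.
move=> sab tab; rewrite distrC [`|s - t|]distrC.
have [|c cst ->] := @MVT_segment R f df s t st (fun u _ => fd u).
  apply: continuous_subspaceT => x; apply: differentiable_continuous.
  by apply/derivable1_diffP; exact: ex_derive.
rewrite normrM ler_wpM2r //; apply: dfM.
move: sab tab cst; rewrite !in_itv /= => /andP[h1 h2] /andP[h3 h4] /andP[h5 h6].
by rewrite (le_trans h1) //= (le_trans h6).
Qed.

Lemma norm_sin_le (x : R) : `|sin x| <= `|x|.
Proof.
wlog x0 : x / 0 <= x.
  move=> H; have [/H//|/ltW x0] := leP 0 x.
  by have := H (- x); rewrite oppr_ge0 sinN !normrN; apply.
have := @ler_MVT sin cos 0 x 1 (fun t => is_derive_sin t) (fun t _ => cos_max t) x 0.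
by rewrite sin0 !subr0 mul1r; apply; rewrite in_itv /= ?x0 ?lexx.
Qed.

Lemma norm_sinDzpi (x : R) (k : int) : `|sin (x + k%:~R * pi)| = `|sin x|.
Proof.
have nat_case (y : R) n : `|sin (y + n%:R * pi)| = `|sin y|.
  rewrite mulr_natl (alternatingn (@sinDpi R)) normrM normrX normrN1 expr1n mul1r //.
case: k => n; first exact: nat_case.
rewrite NegzE mulrNz mulNr -(nat_case (x - n.+1%:R * pi) n.+1).
by rewrite subrK.
Qed.

Lemma uniformly_continuous_itv (f : R -> R * R) (a b e : R) :
  continuous f -> 0 < e ->
  exists2 d, 0 < d & forall s t, s \in `[a, b]%R -> `|s - t| < d -> `|f s - f t| < e.
Proof.
move=> cf e0; have /compact_near_coveringP := @segment_compact R a b.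
move=> /(_ R (0^'+) (fun d s => forall t, `|s - t| < d -> `|f s - f t| < e) _).
have e2 : 0 < e / 2 by rewrite divr_gt0.
case.
  move=> s _.
  have /cvgrPdist_lt /(_ _ e2) /nbhs_ballP[r /= r0 hr] := cf s.
  have r2 : 0 < r / 2 by rewrite divr_gt0.
  exists (ball s (r / 2), [set d | d < r / 2]); rewrite /=.
    by split; [exact: nbhsx_ballx|exact: nbhs_right_lt].
  move=> [s' d] /= [ss' dr] t s't.
  have h1 : `|f s - f s'| < e / 2.
    by apply: hr; rewrite -ball_normE /= in ss' *; lra.
  have h2 : `|f s - f t| < e / 2.
    apply: hr; rewrite -ball_normE /= in ss' *.
    by have := ler_distD s' s t; lra.
  by have := ler_distD (f s) (f s') (f t); rewrite [`|f s' - f s|]distrC; lra.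
move=> d /= d0 hd; exists (d / 2); first by rewrite divr_gt0.
move=> s t sab; apply: hd => //=; last by rewrite divr_gt0.
by rewrite sub0r normrN gtr0_norm ?divr_gt0 //; lra.
Qed.

End Calculus.

(** * Area swept by an arc along a nearly parallel segment *)

Definition tube {R : realType} (eta : R) (p : R * R) (b L : R) : set (R * R) :=
  [set x | exists2 t, 0 <= t <= L & `|x - (p + t *: uvec b)| <= eta].

(** A curve whose tangents make an angle of order [h] with the direction [beta] is,
    at the scale [L], contained in rectangles of size [L] times [h * L]. Moved along
    a segment of length [L] in the direction [beta], and fattened by [h * L], each of
    them still fits in a rectangle of comparable size. There are about
    [S * (b - a) / L] of them, whence the area [h * L * (S * (b - a))], up to a
    constant. *)
Section ArcTube.
Context {R : realType}.
Variables (gamma : R -> R * R) (a b S h beta : R).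
Hypotheses (ab : a < b) (S0 : 0 < S) (h0 : 0 < h) (h1 : h <= 1).
Hypothesis tangential : forall s t, s \in `[a, b]%R -> t \in `[a, b]%R ->
  `|dot (uvec beta) (gamma s - gamma t)| <= S * `|s - t|.
Hypothesis normal : forall s t, s \in `[a, b]%R -> t \in `[a, b]%R ->
  `|dot (nvec beta) (gamma s - gamma t)| <= h * S * `|s - t|.

Lemma lebesgue2_arc_tube (p : R * R) (L : R) : 0 < L -> L <= S * (b - a) ->
  (lebesgue2 (minksum (tube (h * L) p beta L) (gamma @` `[a, b])) <=
   (288 * h * (S * (b - a)) * L)%:E)%E.
Proof.
move=> L0 LS.
have SL0 : 0 < S / L by rewrite divr_gt0.
have len0 : 0 <= S * (b - a) / L by rewrite divr_ge0 ?mulr_ge0 ?subr_ge0 // ltW.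
have h30 : 0 <= 3 / h by rewrite divr_ge0 // ltW.
set K := (Num.truncn (S * (b - a) / L)).+1; set M := (Num.truncn (3 / h)).+1.
pose s i := a + i%:R * (L / S).
pose c (i j : nat) := p + gamma (s i) + (j%:R * (h * L) - L) *: uvec beta.
(* Steps of length L / S in the parameter, then squares of side of order h * L
   along the direction beta. *)
have cover : minksum (tube (h * L) p beta L) (gamma @` `[a, b]) `<=`
   \bigcup_(i in `I_K) \bigcup_(j in `I_M) square (c i j) (3 * (h * L)).
  move=> _ [z [tau /andP[tau0 tauL] hz] [_ [t tab <-] <-]].
  move: (tab); rewrite /= in_itv /= => /andP[at_ tb].
  have ta0 : 0 <= (t - a) * (S / L) by rewrite mulr_ge0 ?subr_ge0 // ltW.
  have /andP[i1 i2] := truncn_itv ta0.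
  set i := Num.truncn _ in i1 i2.
  have si1 : s i <= t by rewrite /s -lerBrDl -[L / S]invf_div ler_pdivrMr.
  have si2 : t - s i <= L / S.
    have : t - a < i.+1%:R * (L / S) by rewrite -[L / S]invf_div ltr_pdivlMr.
    by rewrite /s -natr1; lra.
  have sab : s i \in `[a, b]%R.
    by rewrite in_itv /= (le_trans si1) // andbT /s lerDl mulr_ge0 ?divr_ge0 // ltW.
  set g := gamma t - gamma (s i).
  have st : `|t - s i| <= L / S by rewrite ger0_norm // subr_ge0.
  have SLS : S * (L / S) = L by rewrite mulrC divfK // gt_eqF.
  have rL : `|dot (uvec beta) g| <= L.
    by apply: le_trans (tangential tab sab) _; rewrite -[leRHS]SLS ler_wpM2l // ltW.
  have eL : `|dot (nvec beta) g| <= h * L.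
    apply: le_trans (normal tab sab) _.
    by rewrite -[in leRHS]SLS mulrA ler_wpM2l // mulr_ge0 // ltW.
  set r := dot (uvec beta) g in rL; set e := dot (nvec beta) g in eL.
  have hL0 : 0 < h * L by rewrite mulr_gt0.
  move: rL; rewrite ler_norml => /andP[r1 r2].
  (* Position along beta, shifted by L to be nonnegative. *)
  pose sigma := tau + r + L.
  have sig0 : 0 <= sigma / (h * L) by rewrite divr_ge0 // ?(ltW hL0) // /sigma; lra.
  have /andP[j1 j2] := truncn_itv sig0.
  set j := Num.truncn _ in j1 j2.
  exists i => /=.
    rewrite -(ltr_nat R); apply: le_lt_trans i1 _.
    apply: le_lt_trans (_ : _ <= S * (b - a) / L) _.
      by rewrite mulrCA mulrA ler_wpM2r ?invr_ge0 ?(ltW L0) // ler_wpM2l ?(ltW S0) // lerB.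
    by have /andP[] := truncn_itv len0.
  exists j => /=.
    rewrite -(ltr_nat R); apply: le_lt_trans j1 _.
    apply: le_lt_trans (_ : _ <= 3 / h) _.
      rewrite ler_pdivrMr // mulrA divfK ?gt_eqF // /sigma.
      by lra.
    by have /andP[] := truncn_itv h30.
  rewrite /square /= /c.
  have -> : z + gamma t - (p + gamma (s i) + (j%:R * (h * L) - L) *: uvec beta) =
      (z - (p + tau *: uvec beta)) + ((sigma - j%:R * (h * L)) *: uvec beta +
        e *: nvec beta).
    have gE := uvec_decomp beta g; rewrite -/r -/e in gE.
    have -> : gamma t = gamma (s i) + (r *: uvec beta + e *: nvec beta).
      by rewrite -gE /g addrC subrK.
    rewrite /sigma; apply/eqP; rewrite xpair_eqE /=.
    by rewrite /GRing.scale /=; apply/andP; split; apply/eqP; ring.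
  have -> : 3 * (h * L) = h * L + (h * L + h * L) by ring.
  apply: le_trans (ler_normD _ _) _; apply: lerD => //.
  apply: le_trans (ler_normD _ _) _; rewrite !normrZ; apply: lerD.
    rewrite -[leRHS]mulr1; apply: ler_pM => //; last exact: norm_uvec_le.
    move: j1 j2; rewrite ler_pdivlMr // ltr_pdivrMr // -natr1 => j1 j2.
    by rewrite ger0_norm ?subr_ge0 //; lra.
  by rewrite -[leRHS]mulr1; apply: ler_pM => //; exact: norm_nvec_le.
apply: le_trans (le_lebesgue2 cover) _.
apply: (@le_trans _ _ (K%:R * (M%:R * (2 * (3 * (h * L))) ^+ 2))%:E).
  apply: lebesgue2_bigcup_le_const => i _.
  apply: (lebesgue2_squares_le (c := c i)) => //.
  by rewrite !mulr_ge0 // ltW.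
have KL : K%:R * L <= 2 * (S * (b - a)).
  rewrite /K -natr1 mulrDl mul1r.
  have /andP[+ _] := truncn_itv len0.
  by rewrite ler_pdivlMr // => h2; apply: le_trans (lerD h2 LS) _; rewrite mulr2n mulrDl mul1r.
have Mh : M%:R * h <= 4.
  rewrite /M -natr1 mulrDl mul1r.
  have /andP[+ _] := truncn_itv h30.
  by rewrite ler_pdivlMr // => h2; apply: le_trans (lerD h2 h1) _; lra.
rewrite lee_fin.
have -> : K%:R * (M%:R * (2 * (3 * (h * L))) ^+ 2) =
  36 * h * L * ((K%:R * L) * (M%:R * h)) by ring.
have -> : 288 * h * (S * (b - a)) * L = 36 * h * L * (2 * (S * (b - a)) * 4) by ring.
apply: ler_wpM2l; first by rewrite !mulr_ge0 // ltW.
by apply: ler_pM => //; rewrite mulr_ge0 // ltW.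
Qed.

End ArcTube.

(** * Polygonal paths with labelled edges *)

(** A path from [p] is the sequence of its further vertices, each with a label
    for the edge that ends there. The label of an edge determines which set is
    moved along it. *)
Section Paths.
Context {R : realType} {T : Type}.
Implicit Types (p : R * R) (s : seq ((R * R) * T)) (X : T -> set (R * R)).

Definition path_end p s : R * R := last p (map fst s).
Definition proper_path p s : bool := path (fun x y => x != y) p (map fst s).

Fixpoint plen p s : R :=
  if s is (v, _) :: s' then `|v - p| + plen v s' else 0.

Fixpoint trace p s : set (R * R) :=
  if s is (v, _) :: s' then segment p v `|` trace v s' else set0.

Fixpoint swept X p s : set (R * R) :=
  if s is (v, c) :: s' then minksum (segment p v) (X c) `|` swept X v s' else set0.

Lemma path_end_cat p s1 s2 : path_end p (s1 ++ s2) = path_end (path_end p s1) s2.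
Proof. by rewrite /path_end map_cat last_cat. Qed.

Lemma proper_path_cat p s1 s2 : proper_path p (s1 ++ s2) =
  proper_path p s1 && proper_path (path_end p s1) s2.
Proof. by rewrite /proper_path map_cat cat_path. Qed.

Lemma plen_cat p s1 s2 : plen p (s1 ++ s2) = plen p s1 + plen (path_end p s1) s2.
Proof.
by elim: s1 p => [|[v c] s1 ih] p /=; rewrite ?add0r // ih addrA.
Qed.

Lemma trace_cat p s1 s2 :
  trace p (s1 ++ s2) = trace p s1 `|` trace (path_end p s1) s2.
Proof.
by elim: s1 p => [|[v c] s1 ih] p /=; rewrite ?set0U // ih setUA.
Qed.

Lemma swept_cat X p s1 s2 :
  swept X p (s1 ++ s2) = swept X p s1 `|` swept X (path_end p s1) s2.
Proof.
by elim: s1 p => [|[v c] s1 ih] p /=; rewrite ?set0U // ih setUA.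
Qed.

Lemma swept_sub_trace X (Y : set (R * R)) p s :
  (forall c, X c `<=` Y) -> swept X p s `<=` minksum (trace p s) Y.
Proof.
move=> XY; elim: s p => [|[v c] s ih] p //= x [|/ih].
  by apply: sub_minksum => //; exact: subsetUl.
by apply: sub_minksum => //; exact: subsetUr.
Qed.

Lemma le_swept X X' p s :
  (forall c, X c `<=` X' c) -> swept X p s `<=` swept X' p s.
Proof.
move=> XX; elim: s p => [|[v c] s ih] p //=.
by apply: setUSS => //; exact: sub_minksum.
Qed.

End Paths.

Lemma segment_sub_tube {R : realType} (eta : R) (p : R * R) (phi L : R) :
  0 <= eta -> 0 <= L -> segment p (p + L *: uvec phi) `<=` tube eta p phi L.
Proof.
move=> eta0 L0 _ [t /= + <-]; rewrite in_itv /= => /andP[t0 t1].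
exists (t * L); first by rewrite mulr_ge0 //= ler_piMl.
have -> : (1 - t) *: p + t *: (p + L *: uvec phi) = p + (t * L) *: uvec phi.
  by rewrite scalerDr scalerA addrA -scalerDl subrK scale1r.
by rewrite subrr normr0.
Qed.

(** * Zigzags *)

(** [A] is a family of sets; [near m beta] means that [A m] is almost parallel to the
    direction [beta], and then, by [free], it sweeps little area when moved along a
    short segment in this direction, and more generally along anything that stays
    very close to such a segment. *)
Section Zigzag.
Context {R : realType}.
Variables (J : Type) (A : J -> set (R * R)) (near : J -> R -> Prop).
Variables (w : J -> R) (h L0 : R).
Hypotheses (h0 : 0 < h) (L00 : 0 < L0) (w0 : forall m, 0 <= w m).
Hypothesis free : forall m beta p L, near m beta -> 0 < L -> L <= L0 ->
  (lebesgue2 (minksum (tube (h * L) p beta L) (A m)) <= (w m * L)%:E)%E.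

(** The fan of directions [c], [c + h], up to [c + k * h]. Paths below are built so
    that an edge labelled [c] lies very close to a segment in each of the directions
    of the fan that starts at [c] and has [N] steps; what is almost parallel to one
    of these is moved, and the rest, whose directions lie in the remaining gap of
    size [pi - N * h], is dropped. *)
Definition covered (m : J) (c : R) (k : nat) : Prop :=
  exists2 i : nat, (i <= k)%N & near m (c + i%:R * h).

Definition kept (m : J) (N : nat) (c : R) : set (R * R) :=
  [set x | A m x /\ covered m c N].

(** A segment of length [L] in direction [phi] can be replaced by a path within
    [eta], at most [Lam] times as long, along which every [A m] with [M m] sweeps
    little. The bound for each [m] is proportional to the length, so that it adds up
    under concatenation; no bound is summed over [m] before the very end. *)
Definition good (M : J -> Prop) (N : nat) (Lam eta phi : R) (p : R * R) (L : R) :=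
  exists s : seq ((R * R) * R),
    [/\ path_end p s = p + L *: uvec phi, proper_path p s,
        trace p s `<=` tube eta p phi L, plen p s <= Lam * L &
        forall m, M m -> (lebesgue2 (swept (kept m N) p s) <= (w m * (Lam * L))%:E)%E].

Implicit Types (M : J -> Prop) (N : nat) (p : R * R).

Lemma good_sub M M' N Lam eta eta' phi p L : (forall m, M' m -> M m) -> eta <= eta' ->
  good M N Lam eta phi p L -> good M' N Lam eta' phi p L.
Proof.
move=> MM ee [s [e nd tr le a]]; exists s; split=> // [|m /MM]; last exact: a.
by move=> x /tr[t tL hx]; exists t => //; exact: le_trans ee.
Qed.

(** What the fan misses is dropped, and sweeps nothing. *)
Lemma good_base N c eta phi p L : 0 < eta -> 0 < L ->
  good (fun m => ~ covered m c N) N 1 eta phi p L.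
Proof.
move=> eta0 L_gt0; exists [:: (p + L *: uvec phi, c)]; split => //=.
- rewrite /proper_path /= andbT eq_sym -subr_eq0 addrC addKr scaler_eq0.
  rewrite negb_or gt_eqF //=; apply/eqP => /(congr1 (dot (uvec phi))).
  by rewrite /dot /= !mulr0 addr0 -!expr2 cos2Dsin2 => /eqP; rewrite oner_eq0.
- by rewrite setU0; apply: segment_sub_tube; exact: ltW.
- rewrite addr0 mul1r addrC addKr normrZ gtr0_norm // -[leRHS]mulr1.
  by rewrite ler_wpM2l ?norm_uvec_le // ltW.
- move=> m ncov; rewrite setU0.
  rewrite (_ : minksum _ _ = set0); last first.
    by apply/seteqP; split=> // x [z _ [y [_ /ncov]]].
  by rewrite outer_measure0 lee_fin mulr_ge0 // mul1r ltW.
Qed.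

Lemma good_add M N Lam eta phi p L1 L2 : 0 <= L1 -> 0 <= L2 ->
  good M N Lam eta phi p L1 -> good M N Lam eta phi (p + L1 *: uvec phi) L2 ->
  good M N Lam eta phi p (L1 + L2).
Proof.
move=> L10 L20 [s1 [e1 nd1 tr1 le1 a1]] [s2 [e2 nd2 tr2 le2 a2]].
exists (s1 ++ s2); split.
- by rewrite path_end_cat e1 e2 scalerDl addrA.
- by rewrite proper_path_cat nd1 e1.
- rewrite trace_cat e1 => x [/tr1|/tr2] [t /andP[t0 tL] hx].
    by exists t => //; rewrite t0 (le_trans tL) // lerDl.
  by exists (L1 + t); [rewrite addr_ge0 //= lerD2l|rewrite scalerDl addrA].
- by rewrite plen_cat e1 mulrDr lerD.
- move=> m Mm; rewrite swept_cat e1.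
  apply: le_trans; first exact: (outer_measureU2 (@lebesgue2 R)).
  by rewrite !mulrDr EFinD; apply: leeD; [exact: a1|exact: a2].
Qed.

Lemma good_small M N Lam eta phi (d0 : R) : 0 < d0 ->
  (forall p d, 0 < d -> d <= d0 -> good M N Lam eta phi p d) ->
  forall p L, 0 < L -> good M N Lam eta phi p L.
Proof.
move=> d00 hd p L L_gt0.
have /andP[_ n2] := truncn_itv (ltW (divr_gt0 L_gt0 d00)).
set n := Num.truncn _ in n2.
have n0 : 0 < n.+1%:R :> R by rewrite ltr0n.
have dd0 : L / n.+1%:R <= d0.
  by rewrite ler_pdivrMr // mulrC -ler_pdivrMr // ltW.
have d_gt0 : 0 < L / n.+1%:R by rewrite divr_gt0.
have key i : good M N Lam eta phi p (i.+1%:R * (L / n.+1%:R)).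
  elim: i => [|i ih]; first by rewrite mul1r; exact: hd.
  rewrite -[i.+2]addn1 natrD mulrDl mul1r; apply: good_add => //; last exact: hd.
    by rewrite mulr_ge0 // ltW.
  exact: ltW.
by have := key n; rewrite mulrC divfK // gt_eqF.
Qed.

(** All the refinements of a short segment stay in a thin tube around it, so the
    sets almost parallel to it are taken care of once and for all. *)
Lemma good_absorb M N Lam eta phi p L : 0 < L -> L <= L0 -> eta <= h * L -> 1 <= Lam ->
  good M N Lam eta phi p L -> good (fun m => M m \/ near m phi) N Lam eta phi p L.
Proof.
move=> L_gt0 LL0 etah Lam1 [s [e nd tr le a]]; exists s; split=> // m [/a//|mphi].
apply: le_trans (_ : (w m * L)%:E <= _)%E; last first.
  by rewrite lee_fin ler_wpM2l // ler_peMl // ltW.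
apply: le_trans (free p mphi L_gt0 LL0); apply: le_lebesgue2.
apply: (@subset_trans _ (minksum (trace p s) (A m))).
  by apply: swept_sub_trace => c x [].
apply: sub_minksum => // x /tr[t tL hx]; exists t => //; exact: le_trans etah.
Qed.

(** Replace the segment by many small steps alternately in the directions [b1] and
    [b2]; when the steps are small enough, the zigzag stays within [eta]. *)
Lemma good_zigzag M N Lam phi b1 b2 (x1 x2 : R) :
  0 < x1 -> 0 < x2 -> uvec phi = x1 *: uvec b1 + x2 *: uvec b2 ->
  (forall p L eta, 0 < L -> L <= L0 -> 0 < eta -> good M N Lam eta b1 p L) ->
  (forall p L eta, 0 < L -> L <= L0 -> 0 < eta -> good M N Lam eta b2 p L) ->
  forall p L eta, 0 < L -> 0 < eta -> good M N (Lam * (x1 + x2)) eta phi p L.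
Proof.
move=> x10 x20 uE g1 g2 p L eta L_gt0 eta0; move: p L L_gt0.
have x12 : 0 < x1 + x2 by rewrite addr_gt0.
pose d0 := Num.min L0 (eta / 2) / (x1 + x2).
have m0 : 0 < Num.min L0 (eta / 2) by rewrite lt_min L00 divr_gt0.
apply: (good_small (d0 := d0)); first by rewrite divr_gt0.
move=> p d d_gt0; rewrite ler_pdivlMr // le_min => /andP[dL0 deta].
have d1 : 0 < x1 * d by rewrite mulr_gt0.
have d2 : 0 < x2 * d by rewrite mulr_gt0.
have eta2 : 0 < eta / 2 by rewrite divr_gt0.
have dE : d * (x1 + x2) = x1 * d + x2 * d by ring.
have [|s1 [e1 nd1 tr1 le1 a1]] := g1 p (x1 * d) (eta / 2) d1 _ eta2; first by lra.
have [|s2 [e2 nd2 tr2 le2 a2]] :=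
  g2 (p + (x1 * d) *: uvec b1) (x2 * d) (eta / 2) d2 _ eta2; first by lra.
exists (s1 ++ s2); split.
- rewrite path_end_cat e1 e2 uE scalerDr !scalerA addrA.
  by rewrite ![d * _]mulrC.
- by rewrite proper_path_cat nd1 e1.
- rewrite trace_cat e1 => x trx; exists 0; rewrite ?lexx ?(ltW d_gt0) // scale0r addr0.
  case: trx => [/tr1|/tr2] [t /andP[t0 tL] hx].
    have := ler_distD (p + t *: uvec b1) x p.
    rewrite (_ : p + t *: uvec b1 - p = t *: uvec b1); last by rewrite addrC addKr.
    rewrite normrZ ger0_norm //.
    by have := ler_wpM2l t0 (norm_uvec_le b1); lra.
  have := ler_distD (p + (x1 * d) *: uvec b1 + t *: uvec b2) x p.
  rewrite (_ : p + (x1 * d) *: uvec b1 + t *: uvec b2 - p =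
    (x1 * d) *: uvec b1 + t *: uvec b2); last by apply/eqP; rewrite subr_eq [eqbRHS]addrC addrA.
  have := ler_normD ((x1 * d) *: uvec b1) (t *: uvec b2).
  rewrite (normrZ (x1 * d)) (normrZ t) (ger0_norm t0) (gtr0_norm d1).
  have := ler_wpM2l t0 (norm_uvec_le b2); have := ler_wpM2l (ltW d1) (norm_uvec_le b1).
  by lra.
- rewrite plen_cat e1 -mulrA [(x1 + _) * d]mulrC dE mulrDr; exact: lerD.
- move=> m Mm; rewrite swept_cat e1.
  apply: le_trans; first exact: (outer_measureU2 (@lebesgue2 R)).
  rewrite -mulrA [(x1 + _) * d]mulrC dE !mulrDr EFinD.
  by apply: leeD; [exact: a1|exact: a2].
Qed.

(** A potential for lengths: a zigzag from an extreme direction of a fan with [k] steps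
    to its two neighbouring directions multiplies lengths by [fan k / fan k.+1], so
    the product of these factors over the generations telescopes. *)
Definition fan (k : nat) : R := cos (k%:R * h / 2) * cos (k.+1%:R * h / 2).

Lemma fan_arg (k N : nat) : (k <= N)%N -> N%:R * h < pi ->
  0 <= k%:R * h / 2 <= N%:R * h / 2 /\ N%:R * h / 2 < pi / 2.
Proof.
move=> kN Nh; split; last by rewrite ltr_pM2r ?invr_gt0.
apply/andP; split; first by rewrite divr_ge0 // mulr_ge0 // ltW.
by rewrite ler_wpM2r ?invr_ge0 // ler_wpM2r ?ler_nat // ltW.
Qed.

Lemma cos_fan_gt0 (k N : nat) : (k <= N)%N -> N%:R * h < pi -> 0 < cos (k%:R * h / 2).
Proof.
move=> kN Nh; have [/andP[h1 h2] h3] := fan_arg kN Nh.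
by apply: cos_gt0_pihalf; apply/andP; split; have := @pi_gt0 R; lra.
Qed.

Lemma fan_gt0 (k N : nat) : (k < N)%N -> N%:R * h < pi -> 0 < fan k.
Proof.
by move=> kN Nh; rewrite /fan mulr_gt0 //; apply: (cos_fan_gt0 _ Nh); lia.
Qed.

Lemma le_fan (k k' : nat) : (k <= k')%N -> k'.+1%:R * h < pi -> fan k' <= fan k.
Proof.
move=> kk Nh; have le_cos i j : (i <= j)%N -> (j <= k'.+1)%N ->
    cos (j%:R * h / 2) <= cos (i%:R * h / 2).
  move=> ij jk; have [/andP[a1 a2] a3] := fan_arg jk Nh.
  have jh : j%:R * h < pi by have := @pi_gt0 R; lra.
  have [/andP[b1 b2] b3] := fan_arg ij jh.
  have := @pi_gt0 R => pi0.
  have ii : i%:R * h / 2 \in `[0, pi]%R by rewrite in_itv /=; apply/andP; split; lra.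
  have jj : j%:R * h / 2 \in `[0, pi]%R by rewrite in_itv /=; apply/andP; split; lra.
  by rewrite leNgt ltr_cos // -leNgt.
by rewrite /fan; apply: ler_pM; do ?[apply: ltW; apply: (cos_fan_gt0 _ Nh); lia];
  apply: le_cos; lia.
Qed.

Lemma uvec_split (b D x : R) : sin D != 0 ->
  uvec (b + x) = (sin x / sin D) *: uvec (b + D) + (sin (D - x) / sin D) *: uvec b.
Proof.
move=> sD; rewrite /uvec sinB !sinD !cosD.
by congr pair; rewrite /= /GRing.scale /=; field.
Qed.

Lemma fan_ratio (k : nat) : k.+2%:R * h < pi ->
  (sin h + sin (k.+1%:R * h)) / sin (k.+2%:R * h) = fan k / fan k.+1.
Proof.
move=> kh; pose P := k.+2%:R * h / 2; pose Q := k%:R * h / 2.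
have hE : h = P - Q by rewrite /P /Q -[k.+2]addn2 natrD; field.
have kE : k.+1%:R * h = P + Q by rewrite /P /Q -[k.+2]addn2 natrD -natr1; field.
have PE : k.+2%:R * h = P + P by rewrite /P; field.
have cP : 0 < cos P by apply: (cos_fan_gt0 (leqnn _) kh).
have cQ1 : 0 < cos (k.+1%:R * h / 2) by apply: (cos_fan_gt0 _ kh).
have sP : 0 < sin P.
  have [/andP[p1 _] p2] := fan_arg (leqnn k.+2) kh.
  apply: sin_gt0_pihalf; rewrite p2 andbT /P divr_gt0 //.
  by rewrite mulr_gt0 ?ltr0n.
rewrite /fan -/P -/Q {1}hE kE PE sinB !sinD.
have -> : sin P * cos P + cos P * sin P = 2 * (sin P * cos P) by ring.
by field; rewrite -kE !gt_eqF.
Qed.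

(** Induction on the number [n] of steps by which the fan still has to grow. A segment
    in an extreme direction of the fan is replaced by a zigzag whose two directions
    are the next one at each end. Each side of the zigzag frees one more direction,
    and is itself extreme in a fan with one more step. Going to the neighbouring
    directions, and not to arbitrary ones, is what keeps the total length bounded:
    most of the length stays on the side close to the original direction. *)
Lemma good_fan (n k : nat) (c phi : R) : phi = c \/ phi = c + k%:R * h ->
  (k + n).+1%:R * h < pi ->
  forall p L eta, 0 < L -> 0 < eta ->
  good (fun m => ~ covered m c k) (k + n) (fan k / fan (k + n)) eta phi p L.
Proof.
elim: n k c phi => [|n ih] k c phi phiE knh p L eta L_gt0 eta0.
  have kh : 0 < fan k by apply: (fan_gt0 _ knh); rewrite addn0 ltnSn.
  by rewrite addn0 divff ?gt_eqF //; exact: good_base.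
have le_kh (j : nat) : (j <= (k + n.+1).+1)%N -> j%:R * h < pi.
  by move=> jk; apply: le_lt_trans knh; rewrite ler_wpM2r ?ler_nat // ltW.
have k2n : (k.+2 <= (k + n.+1).+1)%N by rewrite addnS !ltnS leq_addr.
have kh2 : k.+2%:R * h < pi by exact: le_kh.
pose D := k.+2%:R * h; pose b2 := c - h; pose x := phi - b2; pose b1 := b2 + D.
have b1E : b1 = c + k.+1%:R * h by rewrite /b1 /b2 /D -[k.+2]addn1 natrD; ring.
have xD : (x = h /\ D - x = k.+1%:R * h) \/ (x = k.+1%:R * h /\ D - x = h).
  rewrite /x; case: phiE => ->; [left|right]; split;
    by rewrite /b2 /D -?[k.+2]addn2 -?natr1 ?natrD; ring.
have sin_pos (j : nat) : (0 < j)%N -> (j <= k.+2)%N -> 0 < sin (j%:R * h).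
  move=> j0 jk; apply: sin_gt0_pi; rewrite mulr_gt0 ?ltr0n //=.
  by apply: le_kh; exact: leq_trans k2n.
have sD : 0 < sin D by exact: sin_pos.
have sh : 0 < sin h by rewrite -[h]mul1r; exact: (sin_pos 1%N).
have skh : 0 < sin (k.+1%:R * h) by exact: sin_pos.
have sx : 0 < sin x by case: xD => -[-> _].
have sDx : 0 < sin (D - x) by case: xD => -[_ ->].
have fk1 : 0 < fan k.+1 by exact: (fan_gt0 (ltnSn _) kh2).
have fN : 0 < fan (k + n.+1) by exact: (fan_gt0 (ltnSn _) knh).
have ratio1 : 1 <= fan k.+1 / fan (k + n.+1).
  by rewrite ler_pdivlMr // mul1r; apply: le_fan => //; rewrite addnS ltnS leq_addr.
have stretch : fan k / fan (k + n.+1) =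
    fan k.+1 / fan (k + n.+1) * (sin x / sin D + sin (D - x) / sin D).
  rewrite -mulrDl (_ : sin x + sin (D - x) = sin h + sin (k.+1%:R * h)).
    by rewrite /D fan_ratio //; field; rewrite !gt_eqF.
  by case: xD => -[-> ->] //; rewrite addrC.
have step b c' : (b = c' \/ b = c' + k.+1%:R * h) ->
    (forall m, ~ covered m c k -> ~ covered m c' k.+1 \/ near m b) ->
    forall p L eta, 0 < L -> L <= L0 -> 0 < eta ->
    good (fun m => ~ covered m c k) (k + n.+1) (fan k.+1 / fan (k + n.+1)) eta b p L.
  move=> bE cov p' L' eta' L'0 L'L0 eta'0.
  have e0 : 0 < Num.min eta' (h * L') by rewrite lt_min eta'0 mulr_gt0.
  apply: (@good_sub (fun m => ~ covered m c' k.+1 \/ near m b) _ _ _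
    (Num.min eta' (h * L'))) => //; first by rewrite ge_min lexx.
  apply: good_absorb => //; first by rewrite ge_min lexx orbT.
  by rewrite -addSnnS in knh *; exact: ih.
rewrite stretch; apply: (good_zigzag (b1 := b1) (b2 := b2)) => //.
- by rewrite divr_gt0.
- by rewrite divr_gt0.
- by rewrite -uvec_split ?gt_eqF // /x addrC subrK.
- apply: (step _ c); first by right.
  move=> m ncov; have [nb|nnb] := pselect (near m b1); [by right|left].
  move=> [i]; rewrite leq_eqVlt => /predU1P[->|ik] nc.
    by apply: nnb; rewrite b1E.
  by apply: ncov; exists i.
- apply: (step _ b2); first by left.
  move=> m ncov; have [nb|nnb] := pselect (near m b2); [by right|left].
  move=> [[|i] ik] nc; first by apply: nnb; rewrite mul0r addr0 in nc.
  apply: ncov; exists i => //; move: nc.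
  by rewrite /b2 -natr1 mulrDl mul1r [i%:R * h + h]addrC addrA subrK.
Qed.

(** The sets almost parallel to the initial segment are handled by cutting it into
    pieces shorter than [L0]. *)
Lemma good_all (N : nat) (phi : R) : N.+1%:R * h < pi ->
  forall p L eta, 0 < L -> 0 < eta ->
  good (fun=> True) N (fan N)^-1 eta phi p L.
Proof.
move=> Nh p L eta L_gt0 eta0; have fN : 0 < fan N by exact: (fan_gt0 _ Nh).
have f1 : 1 <= (fan N)^-1.
  rewrite invf_ge1 // /fan.
  have c1 := cos_le1 (N%:R * h / 2); have c2 := cos_le1 (N.+1%:R * h / 2).
  have c3 := cos_fan_gt0 (leqnSn N) Nh; have c4 := cos_fan_gt0 (leqnn N.+1) Nh.
  by nra.
move: p L L_gt0; apply: (good_small (d0 := L0)) => // p d d_gt0 dL0.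
have e0 : 0 < Num.min eta (h * d) by rewrite lt_min eta0 mulr_gt0.
apply: (@good_sub (fun m => ~ covered m phi 0 \/ near m phi) _ _ _
    (Num.min eta (h * d))); last apply: good_absorb => //.
- move=> m _; have [nb|nnb] := pselect (near m phi); [by right|left].
  by move=> [[|//] _]; rewrite mul0r addr0.
- by rewrite ge_min lexx.
- by rewrite ge_min lexx orbT.
have [s [e nd tr le a]] := @good_fan N 0 phi phi (or_introl erefl) Nh p d
  (Num.min eta (h * d)) d_gt0 e0.
have f0 : fan 0 / fan N <= (fan N)^-1.
  by rewrite ler_piMl ?invr_ge0 ?(ltW fN) // /fan !mul0r cos0 mul1r cos_le1.
exists s; split => //.
  by apply: le_trans le _; rewrite ler_wpM2r // ltW.
move=> m /a /le_trans; apply.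
by rewrite lee_fin ler_wpM2l // ler_wpM2r // ltW.
Qed.

End Zigzag.

(** * Directions modulo pi *)

Section Directions.
Context {R : realType}.
Implicit Types (a b c x : R).

Lemma polar (v : R * R) : v != 0 -> exists r a, 0 < r /\ v = r *: uvec a.
Proof.
move=> v0; pose r := Num.sqrt (v.1 ^+ 2 + v.2 ^+ 2).
have s0 : 0 < v.1 ^+ 2 + v.2 ^+ 2.
  rewrite lt_neqAle addr_ge0 ?sqr_ge0 // andbT eq_sym paddr_eq0 ?sqr_ge0 //.
  rewrite !sqrf_eq0; apply: contra v0 => /andP[/eqP v1 /eqP v2].
  by rewrite [v]surjective_pairing v1 v2.
have r0 : 0 < r by rewrite sqrtr_gt0.
have rE : r ^+ 2 = v.1 ^+ 2 + v.2 ^+ 2 by rewrite sqr_sqrtr // ltW.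
have x1 : -1 <= v.1 / r <= 1.
  rewrite ler_pdivlMr // ler_pdivrMr // mulN1r mul1r -ler_norml.
  by rewrite -sqrtr_sqr ler_wsqrtr // lerDl sqr_ge0.
have cE : r * cos (acos (v.1 / r)) = v.1.
  by rewrite acosK ?in_itv //= mulrC divfK // gt_eqF.
have sE : r * sin (acos (v.1 / r)) = `|v.2|.
  rewrite sin_acos // -[X in X * _](gtr0_norm r0) -[`|r|]sqrtr_sqr -sqrtrM ?sqr_ge0 //.
  rewrite -sqrtr_sqr; congr Num.sqrt; rewrite mulrBr mulr1 expr_div_n.
  by rewrite mulrC divfK ?expf_eq0 ?gt_eqF // rE; ring.
have [v20|/ltW v20] := leP 0 v.2.
  exists r, (acos (v.1 / r)); split => //; rewrite [LHS]surjective_pairing.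
  by rewrite -[in LHS]cE -[in LHS](ger0_norm v20) -[in LHS]sE.
exists r, (- acos (v.1 / r)); split => //; rewrite [LHS]surjective_pairing.
rewrite -[in LHS]cE -[v.2]opprK -[in LHS](ler0_norm v20) -[in LHS]sE.
by rewrite /uvec cosN sinN -mulrN.
Qed.

Lemma sin_small x (d : R) : 0 < d -> d <= pi / 2 -> `|sin x| < sin d ->
  exists k : int, `|x - k%:~R * pi| < d.
Proof.
move=> d0 dpi sinx; have pi0 := @pi_gt0 R.
pose k := Num.floor (x / pi + 1 / 2); exists k.
set y := x - k%:~R * pi.
have [k1 k2] : k%:~R <= x / pi + 1 / 2 /\ x / pi + 1 / 2 < k%:~R + 1.
  by have := floor_itv (x / pi + 1 / 2); rewrite intrD => /andP[].
have xE : x = (x / pi) * pi by rewrite divfK // gt_eqF.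
have y1 : - (pi / 2) <= y.
  by rewrite /y [X in X - _]xE; move: (k%:~R) k1 k2 => z; nra.
have y2 : y <= pi / 2.
  by rewrite /y [X in X - _]xE; move: (k%:~R) k1 k2 => z; nra.
have xy : `|sin x| = `|sin y| by rewrite -(norm_sinDzpi y k) /y subrK.
move: sinx; rewrite xy ltr_norml => /andP[s1 s2]; rewrite ltr_norml; apply/andP; split.
  by rewrite -ltr_sin ?sinN // in_itv /=; apply/andP; split; lra.
by rewrite -ltr_sin // in_itv /=; apply/andP; split; lra.
Qed.

Lemma dir_of_angleDzpi a (k : int) : dir_of_angle (a + k%:~R * pi) = dir_of_angle a.
Proof. by apply/eqquotP/asboolP; exists k; rewrite addrC addKr. Qed.

Lemma dir_ball_angle a b (k : int) (e : R) : `|a - b - k%:~R * pi| < e ->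
  dir_ball (dir_of_angle a) e (dir_of_angle b).
Proof.
move=> h; apply: le_lt_trans h; apply: ge_inf.
  by exists 0 => _ [a' [b' [_ _ ->]]].
exists a, (b + k%:~R * pi); split => //; first exact: dir_of_angleDzpi.
by rewrite opprD addrA.
Qed.

Definition nearly_parallel (h a b : R) : Prop :=
  exists k : int, `|b - a - k%:~R * pi| <= h.

(** Reduce [a] modulo pi to the interval of length [pi] that starts at [c]: it falls
    either between two directions of the fan, or in the gap that follows the fan. *)
Lemma fan_covers (h c a e : R) (N : nat) : 0 < h -> pi - N%:R * h <= e ->
  (exists2 i : nat, (i <= N)%N & nearly_parallel h a (c + i%:R * h)) \/
  exists k : int, `|c + N%:R * h - a - k%:~R * pi| < e.
Proof.
move=> h0 Nh; have pi0 := @pi_gt0 R; pose k := Num.floor ((a - c) / pi).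
pose y := a - c - k%:~R * pi.
have [k1 k2] : k%:~R * pi <= a - c /\ a - c < (k%:~R + 1) * pi.
  have := floor_itv ((a - c) / pi); rewrite intrD => /andP[+ +].
  by rewrite ler_pdivlMr // ltr_pdivrMr.
have y0 : 0 <= y by rewrite subr_ge0.
have ypi : y < pi by rewrite /y; lra.
have yE z : c + z - a - (- k)%:~R * pi = z - y by rewrite intrN /y; ring.
have [yN|Ny] := leP y (N%:R * h); [left|right].
  have yh0 : 0 <= y / h by rewrite divr_ge0 // ltW.
  have /andP[i1 i2] := truncn_itv yh0.
  exists (Num.truncn (y / h)).
    by rewrite -(ler_nat R) (le_trans i1) // ler_pdivrMr.
  exists (- k); rewrite yE.
  move: i1 i2; rewrite -natr1 ler_pdivlMr // ltr_pdivrMr // => i1 i2.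
  by rewrite ler_norml; apply/andP; split; lra.
exists (- k); rewrite yE ltr_norml; apply/andP; split; lra.
Qed.

End Directions.

(** * Cutting a curve into nearly straight arcs *)

Section CurveArcs.
Context {R : realType}.
Variables (gamma : R -> R * R) (a b : R).
Hypothesis C1 : C1_curve gamma a b.
Let dgamma : R -> R * R := (gamma^`())%classic.

Lemma C1_curve_closed : closed (gamma @` `[a, b]).
Proof.
have [_ dg _ _] := C1.
apply: compact_closed; first exact: norm_hausdorff.
apply: continuous_compact; last exact: segment_compact.
apply: continuous_subspaceT => t; apply: differentiable_continuous.
by apply/derivable1_diffP; exact: dg.
Qed.

Lemma C1_curve_speed : exists sigma S : R, [/\ 0 < sigma, 0 < S &
  forall t, t \in `[a, b]%R -> sigma <= `|dgamma t| <= S].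
Proof.
have [ab _ cg g0] := C1.
have cn : {within `[a, b], continuous (fun t => `|dgamma t|)}.
  by apply: continuous_subspaceT => t; apply: cvg_norm; exact: cg.
have [t1 t1ab max1] := EVT_max (ltW ab) cn.
have [t2 t2ab min2] := EVT_min (ltW ab) cn.
exists `|dgamma t2|, `|dgamma t1|; split.
- by rewrite normr_gt0; exact: g0.
- by rewrite normr_gt0; exact: g0.
- by move=> t tab; apply/andP; split; [exact: min2|exact: max1].
Qed.

(** By uniform continuity of the derivative, which does not vanish, the tangent
    direction varies by at most about [h] on each of [n] arcs of equal parameter
    length. The quantity [l], of the order of the length of the curve, is chosen
    before [h]: the total cost of the arcs is of order [h * l], which tends to 0. *)
Lemma C1_curve_arcs : exists l : R, 0 < l /\ forall h : R, 0 < h -> h <= 1 ->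
  exists (n : nat) (A : nat -> set (R * R)) (alpha : nat -> R), [/\ (0 < n)%N,
    forall i beta p L, (i < n)%N -> nearly_parallel h (alpha i) beta ->
      0 < L -> L <= l / n%:R ->
      (lebesgue2 (minksum (tube (h * L) p beta L) (A i)) <=
       (288 * h * (l / n%:R) * L)%:E)%E &
    forall x u, (gamma @` `[a, b]) x -> tangent_direction gamma a b x u ->
      exists2 i, (i < n)%N & A i x /\
        exists2 psi, dir_of_angle psi = u & `|sin (psi - alpha i)| <= 2 * h].
Proof.
have [ab dg cg g0] := C1; have [sigma [S [sig0 S0 sigS]]] := C1_curve_speed.
have ba0 : 0 < b - a by rewrite subr_gt0.
exists (4 * S * (b - a)); split; first by rewrite !mulr_gt0.
move=> h h0 h1.
have hsig : 0 < h * sigma by rewrite mulr_gt0.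
have [d d0 osc] := @uniformly_continuous_itv R (dgamma) a b _ cg hsig.
have /andP[_ n1] := truncn_itv (ltW (divr_gt0 ba0 d0)).
set n := (Num.truncn _).+1 in n1.
have n0 : 0 < n%:R :> R by rewrite ltr0n.
have step_d : (b - a) / n%:R < d by rewrite ltr_pdivrMr // mulrC -ltr_pdivrMr.
have step0 : 0 < (b - a) / n%:R by rewrite divr_gt0.
pose t i := a + i%:R * ((b - a) / n%:R).
have tab i : (i <= n)%N -> t i \in `[a, b]%R.
  move=> ile; rewrite in_itv /= /t lerDl mulr_ge0 ?(ltW step0) //=.
  rewrite -lerBrDl mulrCA ler_piMr ?(ltW ba0) // ler_pdivrMr // mul1r ler_nat //.
have tS i : t i.+1 = t i + (b - a) / n%:R by rewrite /t -natr1; ring.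
have sub_arc i s : (i < n)%N -> s \in `[t i, t i.+1]%R -> s \in `[a, b]%R.
  move=> iln; move: (tab i (ltnW iln)) (tab i.+1 iln); rewrite !in_itv /=.
  by move=> /andP[h2 _] /andP[_ h3] /andP[h4 h5]; rewrite (le_trans h2) // (le_trans h5).
have /choice[pol polE] : forall i, exists ra : R * R,
    (i < n)%N -> 0 < ra.1 /\ dgamma (t i) = ra.1 *: uvec ra.2.
  move=> i; have [iln|] := boolP (i < n)%N; last by exists (0, 0).
  have [r [al [r0 E]]] := polar (g0 _ (tab i (ltnW iln))).
  by exists (r, al).
have near_t i s : (i < n)%N -> s \in `[t i, t i.+1]%R ->
    `|dgamma s - dgamma (t i)| <= h * sigma.
  move=> iln sI; rewrite distrC; apply: ltW; apply: osc; first by apply: tab; exact: ltnW.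
  move: sI; rewrite tS in_itv /= => /andP[h2 h3].
  by rewrite distrC ger0_norm ?subr_ge0 // (le_lt_trans _ step_d) // lerBlDl.
exists n, (fun i => gamma @` `[t i, t i.+1]), (fun i => (pol i).2); split => //.
- move=> i beta p L iln [k hk] L_gt0 Ll.
  have [] := polE i iln; set r := (pol i).1; set al := (pol i).2 in hk * => r0 vE.
  have len : t i.+1 - t i = (b - a) / n%:R by rewrite tS addrC addKr.
  have lE : 4 * S * (b - a) / n%:R = 4 * S * (t i.+1 - t i) by rewrite len mulrA.
  rewrite lE in Ll *.
  have tt : t i < t i.+1 by rewrite -subr_gt0 len.
  have S4 : 0 < 4 * S by rewrite mulr_gt0.
  have bound w M : (forall s, s \in `[t i, t i.+1]%R -> `|dot w (dgamma s)| <= M) ->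
      forall s s', s \in `[t i, t i.+1]%R -> s' \in `[t i, t i.+1]%R ->
      `|dot w (gamma s - gamma s')| <= M * `|s - s'|.
    move=> hM s s' sI s'I; rewrite dotBr.
    by apply: (ler_MVT (fun s => is_derive_dot w (dg s)) hM).
  have speed s : s \in `[t i, t i.+1]%R -> `|dgamma s| <= S.
    by move=> /(sub_arc _ _ iln)/sigS/andP[].
  apply: lebesgue2_arc_tube => //.
    apply: bound => s /speed sS.
    by apply: le_trans (norm_dot_le _ (norm_uvec_le beta)) _; lra.
  apply: bound => s sI.
  have -> : dot (nvec beta) (dgamma s) = dot (nvec beta) (dgamma (t i)) +
      dot (nvec beta) (dgamma s - dgamma (t i)) by rewrite -dotDr addrC subrK.
  have sin_h : `|sin (al - beta)| <= h.
    rewrite -(norm_sinDzpi _ k); apply: le_trans (norm_sin_le _) _.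
    by rewrite -normrN !opprD opprK [- al + _]addrC.
  have rS : r <= 2 * S.
    have : dot (uvec al) (dgamma (t i)) = r.
      by rewrite vE dotZr dot_uvec mulr1.
    move=> <-; apply: le_trans (ler_norm _) _.
    apply: le_trans (norm_dot_le _ (norm_uvec_le al)) _; rewrite ler_wpM2l //.
    by apply: speed; rewrite in_itv /= lexx ltW.
  have e1 : `|dot (nvec beta) (dgamma (t i))| <= 2 * S * h.
    rewrite vE dotZr dot_nvec_uvec normrM (gtr0_norm r0).
    by apply: ler_pM => //; exact: ltW.
  have e2 := norm_dot_le (dgamma s - dgamma (t i)) (norm_nvec_le beta).
  have e3 := near_t i s iln sI.
  have sigS' : sigma <= S.
    by have /andP[h2 h3] := sigS _ (tab i (ltnW iln)); exact: le_trans h3.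
  have e4 : h * sigma <= h * S by rewrite ler_wpM2l // ltW.
  by apply: le_trans (ler_normD _ _) _; lra.
- move=> x u [s sab <-] tgt.
  have /andP[sa sb] : a <= s <= b by move: sab; rewrite /= in_itv.
  have [i iln sI] : exists2 i, (i < n)%N & s \in `[t i, t i.+1]%R.
    have [->|sb'] := eqVneq s b.
      exists n.-1; first by rewrite /n.
      have -> : n.-1.+1 = n by [].
      have tn : t n = b by rewrite /t mulrC divfK ?gt_eqF // addrC subrK.
      have tn1 : t n = t n.-1 + (b - a) / n%:R by rewrite -tS.
      by rewrite in_itv /= tn lexx andbT -[leRHS]tn tn1 lerDl ltW.
    have q0 : 0 <= (s - a) / ((b - a) / n%:R) by rewrite divr_ge0 ?subr_ge0 // ltW.
    have /andP[i1 i2] := truncn_itv q0.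
    exists (Num.truncn ((s - a) / ((b - a) / n%:R))).
      rewrite -(ltr_nat R); apply: le_lt_trans i1 _.
      rewrite ltr_pdivrMr // mulrC divfK ?gt_eqF // ltrD2r lt_neqAle sb' //.
    move: i1 i2; rewrite ler_pdivlMr // ltr_pdivrMr // => i1 i2.
    by rewrite in_itv /= /t -lerBrDl i1 /= -lerBlDl ltW.
  exists i => //; split; first by exists s.
  have [v0 [psi [r' [uE vE]]]] := tgt s sab erefl; rewrite -/dgamma in vE.
  exists psi => //.
  have [r0 v0E] := polE i iln; set al := (pol i).2 in v0E *.
  have sg : sigma <= `|r'|.
    have /sigS/andP[h2 _] := sub_arc _ _ iln sI; apply: le_trans h2 _.
    rewrite vE (_ : (_, _) = r' *: uvec psi) // normrZ.
    by rewrite -[leRHS]mulr1 ler_wpM2l // norm_uvec_le.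
  have e1 : r' * sin (psi - al) = dot (nvec al) (dgamma s - dgamma (t i)).
    rewrite dotBr vE v0E (_ : (_, _) = r' *: uvec psi) // !dotZr !dot_nvec_uvec.
    by rewrite subrr sin0 mulr0 subr0.
  have e2 := norm_dot_le (dgamma s - dgamma (t i)) (norm_nvec_le al).
  rewrite -e1 normrM in e2.
  have e3 := near_t i s iln sI.
  have : sigma * `|sin (psi - al)| <= sigma * (2 * h).
    apply: (@le_trans _ _ (`|r'| * `|sin (psi - al)|)); first by rewrite ler_wpM2r.
    by apply: le_trans e2 _; lra.
  by rewrite ler_pM2l.
Qed.

End CurveArcs.

(** * Assembling the path *)

Section SweptFamilies.
Context {R : realType} {T : Type}.
Implicit Types (p : R * R) (s : seq ((R * R) * T)).

Lemma swept_setU (X Y : T -> set (R * R)) p s :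
  swept (fun c => X c `|` Y c) p s `<=` swept X p s `|` swept Y p s.
Proof.
elim: s p => [|[v c] s ih] p //= x [[z zS [y [Xy|Yy] <-]]|/ih[Xx|Yx]].
- by left; left; exists z => //; exists y.
- by right; left; exists z => //; exists y.
- by left; right.
- by right; right.
Qed.

Lemma swept_bigcup (I : Type) (D : set I) (X : I -> T -> set (R * R)) p s :
  swept (fun c => \bigcup_(i in D) X i c) p s `<=` \bigcup_(i in D) swept (X i) p s.
Proof.
elim: s p => [|[v c] s ih] p //= x [[z zS [y [i Di Xy] <-]]|/ih[i Di Xx]].
  by exists i => //; left; exists z => //; exists y.
by exists i => //; right.
Qed.

Lemma swept_map {T' : Type} (f : T -> T') (X : T' -> set (R * R)) p s :
  swept X p [seq (vc.1, f vc.2) | vc <- s] = swept (X \o f) p s.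
Proof. by elim: s p => [|[v c] s ih] p //=; rewrite ih. Qed.

Lemma map_fst_relabel {T' : Type} (f : T -> T') s :
  map fst [seq (vc.1, f vc.2) | vc <- s] = map fst s.
Proof. by rewrite -map_comp; apply: eq_map => -[]. Qed.

Lemma lebesgue2_swept_cst (F : set (R * R)) (tau : R) p s :
  (hausdorff1 F < tau%:E)%E -> proper_path p s ->
  (lebesgue2 (swept (fun=> F) p s) <= (160 * tau * plen p s)%:E)%E.
Proof.
move=> Ftau; elim: s p => [|[v c] s ih] p /=.
  by rewrite mulr0 outer_measure0.
rewrite /proper_path /= => /andP[pv /ih le_s].
apply: le_trans; first exact: (outer_measureU2 (@lebesgue2 R)).
by rewrite mulrDr EFinD; apply: leeD => //; exact: lebesgue2_minksum_segment.
Qed.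

End SweptFamilies.

Lemma exists_pos_lower_bound {R : realType} (x : nat -> R) (n : nat) :
  (forall k, 0 < x k) -> exists2 m, 0 < m & forall k, (k < n)%N -> m <= x k.
Proof.
move=> x0; elim: n => [|n [m m0 hm]]; first by exists 1.
exists (Num.min m (x n)); first by rewrite lt_min m0 x0.
move=> k; rewrite ltnS leq_eqVlt ge_min => /predU1P[->|/hm ->//].
by rewrite lexx orbT.
Qed.

(** The bound depends on the gap [e] left by the fan, not on the number of steps: the
    total length of the path stays bounded as the step [h] tends to 0. *)
Lemma fan_lower_bound {R : realType} (h e : R) (N : nat) : 0 < h -> 0 < e -> e < pi ->
  N.+1%:R * h = pi - e -> sin (e / 2) ^+ 2 <= fan h N.
Proof.
move=> h0 e0 epi Nh; have pi0 := @pi_gt0 R.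
have cE : cos (N.+1%:R * h / 2) = sin (e / 2).
  by rewrite Nh -cosBpihalf -cosN; congr cos; field.
have Nh' : N.+1%:R * h < pi by rewrite Nh; lra.
have cN : sin (e / 2) <= cos (N%:R * h / 2).
  have [/andP[a1 a2] a3] := fan_arg h0 (leqnSn N) Nh'.
  rewrite -cE leNgt ltr_cos -?leNgt.
  - by rewrite ler_pM2r ?invr_gt0 // ler_pM2r // ler_nat.
  - by rewrite in_itv /=; apply/andP; split; lra.
  - by rewrite in_itv /=; apply/andP; split; lra.
have s0 : 0 < sin (e / 2) by apply: sin_gt0_pihalf; apply/andP; split; lra.
by rewrite /fan cE expr2 ler_pM2r.
Qed.

(** For each curve, tangency fails only on a null set; the union of these null sets
    goes into [F], together with what finitely many curves leave out. *)
Lemma rectifiable_split {R : realType} (E : set (R * R))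
    (theta : R * R -> direction R) (tau : R) :
  rectifiable E -> (hausdorff1 E < +oo)%E -> tangent_field E theta -> 0 < tau ->
  exists (gamma : nat -> R -> R * R) (a b : nat -> R) (K : nat) (F : set (R * R)),
  [/\ forall k, C1_curve (gamma k) (a k) (b k), (hausdorff1 F < tau%:E)%E &
    forall x, E x -> F x \/ exists2 k, (k < K)%N &
      (gamma k @` `[a k, b k]) x /\ tangent_direction (gamma k) (a k) (b k) x (theta x)].
Proof.
move=> [gamma [a [b [C1 E0]]]] finE tanE tau0.
pose G k := gamma k @` `[a k, b k].
have clG k : closed (G k) by exact: (C1_curve_closed (C1 k)).
have [K hK] := hausdorff1_finite_exhaustion clG finE E0 tau0.
pose B k := [set x | (G k `&` E) x /\ ~ tangent_direction (gamma k) (a k) (b k) x (theta x)].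
have B0 k : hausdorff1 (B k) = 0%E by exact: tanE (C1 k).
have UB0 : hausdorff1 (\bigcup_k B k) = 0%E.
  apply/eqP; rewrite eq_le hausdorff1_ge0 andbT.
  apply: le_trans (hausdorff1_sigma_subadditive B) _.
  by rewrite eseries0 // => k _ _; rewrite B0.
exists gamma, a, b, K, ((E `\` \bigcup_(k in `I_K) G k) `|` \bigcup_k B k); split => //.
  by apply: le_lt_trans (hausdorff1U _ _) _; rewrite UB0 adde0.
move=> x Ex; have [[k kK Gx]|nG] := pselect ((\bigcup_(k in `I_K) G k) x); last by left; left.
have [tx|ntx] := pselect (tangent_direction (gamma k) (a k) (b k) x (theta x)).
  by right; exists k.
by left; right; exists k.
Qed.

Definition moved {R : realType} (E : set (R * R))
    (theta : R * R -> direction R) (eps : R) (u : direction R) : set (R * R) :=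
  [set x | E x /\ ~ dir_ball u eps (theta x)].

(** Order of the choices: the gap left by the fan, hence the bound [Lam * L] on the
    length of the path; then [tau], hence the finitely many curves and their total
    length [ell]; then the step [h], hence the arcs; and last [L0], of the order of
    their minimal length, which bounds the edges of the first subdivision. *)
Lemma path_between {R : realType} (E : set (R * R))
    (theta : R * R -> direction R) (eps e : R) (p q : R * R) :
  rectifiable E -> (hausdorff1 E < +oo)%E -> tangent_field E theta ->
  0 < eps -> eps <= 1 -> 0 < e -> p != q ->
  exists s : seq ((R * R) * direction R),
    [/\ path_end p s = q, proper_path p s &
        (lebesgue2 (swept (moved E theta eps) p s) < e%:E)%E].
Proof.
move=> rectE finE tanE eps0 eps1 e0 pq; have pi2 := @pi_ge2 R.
have e40 : 0 < eps / 4 by lra.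
have e4pi : eps / 4 < pi by lra.
have e4pi2 : eps / 4 < pi / 2 by lra.
have [L [phi [L_gt0 qpE]]] : exists r a, 0 < r /\ q - p = r *: uvec a.
  by apply: polar; rewrite subr_eq0 eq_sym.
have s80 : 0 < sin (eps / 4 / 2) by apply: sin_gt0_pihalf; apply/andP; split; lra.
pose Lam : R := (sin (eps / 4 / 2) ^+ 2)^-1.
have Lam0 : 0 < Lam by rewrite invr_gt0 exprn_gt0.
have LamL0 : 0 < Lam * L by rewrite mulr_gt0.
(* The areas swept by the exceptional set and by the arcs will each be at most
   e / 4: hence 640 = 4 * 160 here, and 1152 = 4 * 288 in the choice of h. *)
pose tau := e / (640 * (Lam * L)).
have c640 : 0 < 640 :> R by rewrite ltr0n.
have tau0 : 0 < tau by exact: divr_gt0 e0 (mulr_gt0 c640 LamL0).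
have [gamma [a [b [K [F [C1 Ftau EF]]]]]] := rectifiable_split rectE finE tanE tau0.
have /choice[l lP] := fun k => C1_curve_arcs (C1 k).
pose ell := \sum_(k < K) l k.
have l0 k : 0 < l k by have [] := lP k.
have ell0 : 0 <= ell by apply: sumr_ge0 => k _; exact: ltW.
have s40 : 0 < sin (eps / 4) by apply: sin_gt0_pihalf; rewrite e40.
pose h1 := Num.min (eps / 4)
  (Num.min (sin (eps / 4) / 4) (e / (1152 * (ell + 1) * (Lam * L)))).
have ell1 : 0 < ell + 1 by rewrite ltr_wpDl.
have h10 : 0 < h1.
  have c1152 : 0 < 1152 :> R by rewrite ltr0n.
  have c4 : 0 < 4 :> R by rewrite ltr0n.
  rewrite /h1 !lt_min (divr_gt0 eps0 c4) (divr_gt0 s40 c4) /=.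
  exact: divr_gt0 e0 (mulr_gt0 (mulr_gt0 c1152 ell1) LamL0).
have q0 : 0 <= pi / h1 by rewrite divr_ge0 ?pi_ge0 // ltW.
have /andP[_ N1] := truncn_itv q0; set N := Num.truncn _ in N1.
have N0 : 0 < N.+1%:R :> R by rewrite ltr0n.
pose h := (pi - eps / 4) / N.+1%:R.
have h0 : 0 < h by rewrite divr_gt0 // subr_gt0.
have Nh : N.+1%:R * h = pi - eps / 4 by rewrite /h mulrC divfK // gt_eqF.
have hh1 : h <= h1.
  rewrite /h ler_pdivrMr // [h1 * _]mulrC; move: N1; rewrite ltr_pdivrMr // => N1.
  by apply: ltW; apply: lt_trans N1; rewrite gtrBl.
move: hh1; rewrite /h1 !le_min => /andP[h_eps /andP[h_sin h_e]].
have h_1 : h <= 1 by apply: le_trans h_eps _; move: eps1; clear; lra.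
have /choice[D DP] : forall k, exists d : nat * (nat -> set (R * R)) * (nat -> R),
  [/\ (0 < d.1.1)%N,
    forall i beta p L, (i < d.1.1)%N -> nearly_parallel h (d.2 i) beta ->
      0 < L -> L <= l k / d.1.1%:R ->
      (lebesgue2 (minksum (tube (h * L) p beta L) (d.1.2 i)) <=
       (288 * h * (l k / d.1.1%:R) * L)%:E)%E &
    forall x u, (gamma k @` `[a k, b k]) x -> tangent_direction (gamma k) (a k) (b k) x u ->
      exists2 i, (i < d.1.1)%N & d.1.2 i x /\
        exists2 psi, dir_of_angle psi = u & `|sin (psi - d.2 i)| <= 2 * h].
  move=> k; have [_ /(_ h h0 h_1)[n [A [al hA]]]] := lP k.
  by exists (n, A, al).
pose n k := (D k).1.1; pose A k i := (D k).1.2 i; pose al k i := (D k).2 i.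
have n0 k : 0 < (n k)%:R :> R by rewrite ltr0n; have [] := DP k.
have ln0 k : 0 < l k / (n k)%:R by rewrite divr_gt0.
have [L0 L00 hL0] := exists_pos_lower_bound K ln0.
pose near (m : nat * nat) beta :=
  [/\ (m.1 < K)%N, (m.2 < n m.1)%N & nearly_parallel h (al m.1 m.2) beta].
pose w (m : nat * nat) := 288 * h * (l m.1 / (n m.1)%:R).
have c288h : 0 < 288 * h by apply: mulr_gt0 h0; rewrite ltr0n.
have w0 m : 0 <= w m by exact: ltW (mulr_gt0 c288h (ln0 _)).
have free m beta p' L' : near m beta -> 0 < L' -> L' <= L0 ->
    (lebesgue2 (minksum (tube (h * L') p' beta L') (A m.1 m.2)) <= (w m * L')%:E)%E.
  move=> [mK mn mb] L'0 L'L0; have [_ hA _] := DP m.1.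
  by apply: hA => //; apply: le_trans L'L0 _; exact: hL0.
have Nhpi : N.+1%:R * h < pi by rewrite Nh gtrBl.
have e2 : pi - N%:R * h <= eps / 2.
  by move: Nh h_eps; rewrite -natr1 mulrDl mul1r; clear; lra.
have sin2h : 2 * h < sin (eps / 4) by move: h_sin s40; clear; lra.
have [s [endE nds _ lens areas]] := @good_all R (nat * nat) (fun m => A m.1 m.2) near
  w h L0 h0 L00 w0 free N phi Nhpi p L 1 L_gt0 ltr01.
have fanLam : (fan h N)^-1 <= Lam.
  have le_fan := fan_lower_bound h0 e40 e4pi Nh.
  by rewrite lef_pV2 // posrE ?exprn_gt0 //; apply: lt_le_trans le_fan; rewrite exprn_gt0.
have fanLamL : (fan h N)^-1 * L <= Lam * L by exact: ler_wpM2r (ltW L_gt0) _ _ fanLam.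
(* The last direction of the fan: the gap, in which the dropped directions lie,
   starts there. *)
pose lab c := dir_of_angle (c + N%:R * h).
exists [seq (vc.1, lab vc.2) | vc <- s]; split.
- by rewrite /path_end map_fst_relabel -/(path_end p s) endE -qpE addrC subrK.
- by rewrite /proper_path map_fst_relabel.
rewrite swept_map.
have cover c : moved E theta eps (lab c) `<=` F `|` \bigcup_(k in `I_K) \bigcup_(i in `I_(n k))
    kept (fun m => A m.1 m.2) near h (k, i) N c.
  move=> x [Ex nball]; have [Fx|[k kK [Gx tx]]] := EF x Ex; [by left|right].
  have [_ _ hA] := DP k; have [i iln [Ax [psi psiE sinE]]] := hA x (theta x) Gx tx.
  exists k => //; exists i => //; split => //.
  have [[j jN npar]|[z hz]] := fan_covers c (al k i) h0 e2; first by exists j.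
  exfalso; apply: nball; rewrite /lab -psiE.
  have [z' hz'] := sin_small e40 (ltW e4pi2) (le_lt_trans sinE sin2h).
  apply: (dir_ball_angle (k := z - z')); rewrite intrB mulrBl.
  have -> : c + N%:R * h - psi - (z%:~R * pi - z'%:~R * pi) =
      (c + N%:R * h - al k i - z%:~R * pi) - (psi - al k i - z'%:~R * pi) by ring.
  by apply: le_lt_trans (ler_normB _ _) _; move: eps0 hz hz'; rewrite /al; clear; lra.
pose cst_F (c : R) := F.
pose rest (c : R) := \bigcup_(k in `I_K) \bigcup_(i in `I_(n k))
    kept (fun m => A m.1 m.2) near h (k, i) N c.
have sub1 : swept (moved E theta eps \o lab) p s `<=` swept cst_F p s `|` swept rest p s.
  by apply: (subset_trans _ (@swept_setU _ _ cst_F rest p s));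
    apply: le_swept => c; exact: cover.
have sub2 : swept rest p s `<=` \bigcup_(k in `I_K) \bigcup_(i in `I_(n k))
    swept (kept (fun m => A m.1 m.2) near h (k, i) N) p s.
  apply: subset_trans; first exact: swept_bigcup.
  by apply: subset_bigcup => k _; exact: swept_bigcup.
apply: le_lt_trans (le_lebesgue2 sub1) _.
apply: le_lt_trans; first exact: (outer_measureU2 (@lebesgue2 R)).
have areaF : (lebesgue2 (swept cst_F p s) <= (e / 4)%:E)%E.
  apply: le_trans (lebesgue2_swept_cst Ftau nds) _; rewrite lee_fin.
  have -> : e / 4 = 160 * tau * (Lam * L).
    by rewrite /tau; move: (Lam * L) LamL0 => z z0; field; rewrite gt_eqF.
  apply: ler_wpM2l (le_trans lens fanLamL).
  by apply: mulr_ge0 (ltW tau0); rewrite ler0n.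
have area_k k : (lebesgue2 (\bigcup_(i in `I_(n k))
    swept (kept (fun m => A m.1 m.2) near h (k, i) N) p s) <=
    (288 * h * (Lam * L) * l k)%:E)%E.
  apply: le_trans.
    apply: (@lebesgue2_bigcup_le_const _ _ _ (w (k, 0%N) * (Lam * L))) => i iln.
    apply: le_trans (areas (k, i) I) _; rewrite lee_fin.
    exact: ler_wpM2l (w0 _) _ _ fanLamL.
  rewrite lee_fin /w /= [leLHS](_ : _ = 288 * h * (Lam * L) * l k) ?lexx //.
  by move: (Lam * L) => z; field; rewrite gt_eqF.
have area_rest : (lebesgue2 (swept rest p s) <= (e / 4)%:E)%E.
  apply: le_trans (le_lebesgue2 sub2) _.
  apply: le_trans (lebesgue2_bigcup_le (fun k _ => area_k k)) _.
  rewrite lee_fin -mulr_sumr -/ell.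
  have den0 : 0 < 1152 * (ell + 1) * (Lam * L).
    by apply: mulr_gt0 LamL0; apply: mulr_gt0 ell1; rewrite ltr0n.
  move: h_e; rewrite (ler_pdivlMr _ _ den0) => h_e.
  have : 288 * h * (Lam * L) * ell <= 288 * h * (Lam * L) * (ell + 1).
    by apply: ler_wpM2l (ltW (mulr_gt0 c288h LamL0)) _ _ _; rewrite lerDl ler01.
  move/le_trans; apply; rewrite ler_pdivlMr ?ltr0n //.
  by apply: le_trans h_e; rewrite le_eqVlt; apply/orP; left; apply/eqP; ring.
apply: le_lt_trans (leeD areaF area_rest) _.
by rewrite -EFinD lte_fin; move: e0; clear; lra.
Qed.

(** A path has at least one edge, so from [p] to itself one goes away and back. *)
Lemma path_between_any {R : realType} (E : set (R * R))
    (theta : R * R -> direction R) (eps e : R) (p q : R * R) :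
  rectifiable E -> (hausdorff1 E < +oo)%E -> tangent_field E theta ->
  0 < eps -> eps <= 1 -> 0 < e ->
  exists s : seq ((R * R) * direction R),
    [/\ (0 < size s)%N, path_end p s = q, proper_path p s &
        (lebesgue2 (swept (moved E theta eps) p s) < e%:E)%E].
Proof.
move=> rectE finE tanE eps0 eps1 e0; have [<-|pq] := eqVneq p q; last first.
  have [s [es nds as_]] := path_between rectE finE tanE eps0 eps1 e0 pq.
  by exists s; split => //; case: s es {nds as_} => [|//] /eqP; rewrite (negbTE pq).
pose p' := p + uvec 0; have e20 : 0 < e / 2 by rewrite divr_gt0.
have pp' : p != p'.
  rewrite /p' eq_sym -subr_eq0 addrC addKr /uvec cos0 xpair_eqE /=.
  by rewrite oner_eq0.
have p'p : p' != p by rewrite eq_sym.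
have [s1 [e1 nd1 a1]] := path_between rectE finE tanE eps0 eps1 e20 pp'.
have [s2 [e2 nd2 a2]] := path_between rectE finE tanE eps0 eps1 e20 p'p.
exists (s1 ++ s2); split.
- by case: s1 e1 {nd1 a1} => [|//] /eqP; rewrite (negbTE pp').
- by rewrite path_end_cat e1.
- by rewrite proper_path_cat nd1 e1.
rewrite swept_cat e1.
apply: le_lt_trans; first exact: (outer_measureU2 (@lebesgue2 R)).
by have := lteD a1 a2; rewrite -EFinD -splitr.
Qed.

Section Vertices.
Context {R : realType} {T : Type}.
Implicit Types (p : R * R) (s : seq ((R * R) * T)).

Definition vertex p s (i : nat) : R * R := nth p (p :: map fst s) i.
Definition label (t0 : T) s (i : nat) : T := nth t0 (map snd s) i.

Lemma polygonal_path_vertex p q s : (0 < size s)%N -> proper_path p s ->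
  path_end p s = q -> polygonal_path (size s) (vertex p s) p q.
Proof.
move=> s0 nds es; split => //.
  by rewrite -es /path_end (last_nth p) size_map.
by move=> i iln; have /(pathP p) := nds; apply; rewrite size_map.
Qed.

Lemma bigcup_vertex_swept (t0 : T) (X : T -> set (R * R)) p s :
  \bigcup_(i in `I_(size s)) \bigcup_(z in segment (vertex p s i) (vertex p s i.+1))
    [set z + x | x in X (label t0 s i)] `<=` swept X p s.
Proof.
elim: s p => [|[v c] s ih] p x; first by case.
case=> -[_|i iln] [z zS zx]; first by left; exists z.
right; apply: ih; exists i => //; exists z => //.
move: zS; rewrite /vertex /=; congr (segment _ _ z); apply: set_nth_default.
  by rewrite /= size_map; exact: ltnW.
by rewrite size_map.
Qed.

End Vertices.

Theorem theorem1p2 (R : realType) (E : set (R * R))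
    (theta : R * R -> direction R) (eps : R) :
  rectifiable E -> (hausdorff1 E < +oo)%E -> tangent_field E theta ->
  0 < eps ->
  forall q : R * R,
  exists (n : nat) (v : nat -> R * R) (phi : nat -> direction R),
    polygonal_path n v 0 q /\
    (lebesgue2 (\bigcup_(i in `I_n) \bigcup_(p in segment (v i) (v i.+1))
       [set (p + x)%R | x in [set x | E x /\ ~ dir_ball (phi i) eps (theta x)]])
     < eps%:E)%E.
Proof.
move=> rectE finE tanE eps0 q.
(* A smaller radius only makes more of E move. *)
pose eps1 := Num.min eps 1.
have eps10 : 0 < eps1 by rewrite lt_min eps0 ltr01.
have le1 : eps1 <= 1 by rewrite ge_min lexx orbT.
have [s [s0 es nds area]] := path_between_any 0 q rectE finE tanE eps10 le1 eps0.
exists (size s), (vertex 0 s), (label (dir_of_angle 0) s); split.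
  exact: polygonal_path_vertex.
apply: le_lt_trans area; apply: le_lebesgue2.
apply: subset_trans (@bigcup_vertex_swept R _ (dir_of_angle 0) _ _ _).
apply: subset_bigcup => i _; apply: subset_bigcup => z _ _ [x [Ex nb] <-].
exists x => //; split => // h; apply: nb; apply: lt_le_trans h _.
by rewrite ge_min lexx.
Qed.
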